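(* Let $n\geq 9$, $\sigma\in[0,1)$, and let $H$ be an $A_\sigma$-minimizer graph in $\mathcal{G}_{n,\lceil n/2\rceil+1}$. Then $H\cong D_n$ if $n$ is even, and $H\cong W_n$ if $n$ is odd.
   Context: All graphs are finite, simple and connected. For a graph $G$ with adjacency matrix $A(G)$ and diagonal degree matrix $D(G)$, and $\sigma\in[0,1]$, set $A_\sigma(G)=\sigma D(G)+(1-\sigma)A(G)$; its largest eigenvalue $\lambda_\sigma(G)$ is the $A_\sigma$ spectral radius. $\mathcal{G}_{n,\alpha}$ denotes the family of all connected graphs on $n$ vertices with independence number $\alpha$; an $A_\sigma$-minimizer graph in $\mathcal{G}_{n,\alpha}$ is one attaining the minimum of $\lambda_\sigma$ over this family. $D_n$ is the $n$-vertex tree obtained from the path $v_1v_2\cdots v_{n-1}$ by attaching one pendant vertex to $v_2$. $W_n$ is the $n$-vertex tree obtained from the path $v_1v_2\cdots v_{n-2}$ by attaching one pendant vertex to $v_2$ and one pendant vertex to $v_{n-3}$. *)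

(* Defs.v *)
From HB Require Import structures.
From mathcomp Require Import all_boot all_order all_algebra.
From mathcomp Require Import classical_sets reals.

Set Implicit Arguments.
Unset Strict Implicit.
Unset Printing Implicit Defensive.

Import Order.TTheory GRing.Theory Num.Theory.
Local Open Scope ring_scope.

(* Finite simple graphs on the vertex set {0, ..., n-1}. *)
Record sgraph (n : nat) := SGraph {
  adj : rel 'I_n;
  adj_sym : symmetric adj;
  adj_irr : irreflexive adj
}.

Definition connected_graph n (G : sgraph n) : Prop :=
  forall x y : 'I_n, connect (adj G) x y.

Definition isomorphic n (G H : sgraph n) : Prop :=
  exists2 f : 'I_n -> 'I_n,
    bijective f & forall x y, adj H (f x) (f y) = adj G x y.

Definition independent n (G : sgraph n) (S : {set 'I_n}) : bool :=
  [forall x in S, forall y in S, ~~ adj G x y].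

Definition independence_number n (G : sgraph n) : nat :=
  \max_(S : {set 'I_n} | independent G S) #|S|.

Definition degree n (G : sgraph n) (x : 'I_n) : nat := #|[set y | adj G x y]|.

Definition adjacency_mx (R : realType) n (G : sgraph n) : 'M[R]_n :=
  \matrix_(i, j) (adj G i j)%:R.

Definition degree_mx (R : realType) n (G : sgraph n) : 'M[R]_n :=
  diag_mx (\row_i (degree G i)%:R).

Definition A_mx (R : realType) (sigma : R) n (G : sgraph n) : 'M[R]_n :=
  sigma *: degree_mx R G + (1 - sigma) *: adjacency_mx R G.

(* [A_mx sigma G] is a real symmetric matrix, so for [0 < n] its set of
   eigenvalues is finite and nonempty, and this supremum is a maximum. *)
Definition spectral_radius (R : realType) (sigma : R) n (G : sgraph n) : R :=
  sup [set a : R | eigenvalue (A_mx sigma G) a]%classic.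

Definition in_family n (alpha : nat) (G : sgraph n) : Prop :=
  connected_graph G /\ independence_number G = alpha.

Definition minimizer (R : realType) (sigma : R) n (alpha : nat)
    (H : sgraph n) : Prop :=
  in_family alpha H /\
  forall G : sgraph n, in_family alpha G ->
    spectral_radius sigma H <= spectral_radius sigma G.

Section GraphOfRel.
Variables (n : nat) (r : rel nat).

Definition rel_adj : rel 'I_n := fun x y => (x != y) && (r x y || r y x).

Fact rel_adj_sym : symmetric rel_adj.
Proof. by move=> x y; rewrite /rel_adj eq_sym orbC. Qed.

Fact rel_adj_irr : irreflexive rel_adj.
Proof. by move=> x; rewrite /rel_adj eqxx. Qed.

Definition graph_of_rel : sgraph n := SGraph rel_adj_sym rel_adj_irr.
End GraphOfRel.

(* In both trees the path vertex v_k is the ordinal k-1.  In [D_graph] the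
   vertex n-1 is the pendant vertex at v_2; in [W_graph] the vertices n-2 and
   n-1 are the pendant vertices at v_2 and v_(n-3).  These are the intended
   trees for n >= 4 and n >= 5 respectively. *)
Definition D_graph (n : nat) : sgraph n :=
  graph_of_rel n (fun x y : nat =>
    (y == x.+1) && (y < n - 1)%N ||
    (x == 1%N) && (y == n - 1)%N).

Definition W_graph (n : nat) : sgraph n :=
  graph_of_rel n (fun x y : nat =>
    [|| (y == x.+1) && (y < n - 2)%N,
        (x == 1%N) && (y == n - 2)%N |
        (x == n - 4)%N && (y == n - 1)%N]).

(* Main.v *)
Require Import Defs.
From HB Require Import structures.
From mathcomp Require Import boolp classical_sets reals.
From mathcomp Require Import all_boot all_order all_algebra.
From mathcomp Require Import zify ring lra.

(* H has a spanning tree T, whose independence number is at least that of H.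
   Every edge of T has an end outside a maximum independent set S, so n - 1 is at
   most the sum of the degrees outside S.  Hence, for alpha = ceil(n/2) + 1, T has
   a vertex of degree at least 4, or two vertices of degree 3, or n is even and T
   has one vertex of degree 3 with all arms of odd length: accordingly H contains
   K_{1,4}, some W_m with m <= n, or one of D_n and the spider with arms 1, 3, 3.
   A nonnegative x on a subgraph K with <x, A(K) x> >= k |x|^2 forces
   lambda(H) >= k, and, by Perron-Frobenius, lambda(H) > k unless K = H.
   So it suffices to compare the candidate G (D_n or W_n) with each K at
   k = max(lambda(G), 2).  On paths the equation A x = k x has the solutions
   theta^i and theta^-i; gluing them to pendant vertices gives vectors on G and on
   each K which satisfy A x = k x except at the branch vertices (and at the end
   leaf of D_n).  The sign of the error on G is known, as otherwise
   lambda(G) < k, and it determines the sign of the errors on the graphs K. *)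

Set Implicit Arguments.
Unset Strict Implicit.
Unset Printing Implicit Defensive.

Import Order.TTheory GRing.Theory Num.Theory.
Local Open Scope ring_scope.

(** * Rayleigh quotients of symmetric matrices *)

Section SymmetricForms.
Variables (R : realType) (n : nat).
Implicit Types (A : 'M[R]_n) (x y : 'I_n -> R).

Definition mxapp A x (i : 'I_n) : R := \sum_j A i j * x j.

Definition dotp x y : R := \sum_i x i * y i.

Lemma dotpC x y : dotp x y = dotp y x.
Proof. by apply: eq_bigr => i _; rewrite mulrC. Qed.

Lemma mxapp_sym A x y : A^T = A -> dotp x (mxapp A y) = dotp (mxapp A x) y.
Proof.
move=> symA; rewrite /dotp /mxapp.
under eq_bigr do rewrite mulr_sumr.
under [RHS]eq_bigr do rewrite mulr_suml.
rewrite exchange_big /=; apply: eq_bigr => i _; apply: eq_bigr => j _.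
by rewrite -{1}symA mxE; ring.
Qed.

Lemma dotp_ge0 x : 0 <= dotp x x.
Proof. by apply: sumr_ge0 => i _; rewrite -expr2 sqr_ge0. Qed.

Lemma dotp_eq0 x i : dotp x x = 0 -> x i = 0.
Proof.
move=> /eqP; rewrite psumr_eq0 => [|j _]; last by rewrite -expr2 sqr_ge0.
by move=> /allP /(_ i); rewrite mem_index_enum mulf_eq0 orbb => /(_ isT) /eqP.
Qed.

Lemma dotp_gt0 x i : x i != 0 -> 0 < dotp x x.
Proof.
move=> xi; rewrite lt_neqAle dotp_ge0 andbT eq_sym.
by apply/eqP => /(dotp_eq0 i) /eqP; rewrite (negbTE xi).
Qed.

Lemma dotpDl x y z t :
  dotp (fun i => y i + t * x i) z = dotp y z + t * dotp x z.
Proof.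
rewrite /dotp mulr_sumr -big_split /=; apply: eq_bigr => i _; ring.
Qed.

Lemma dotpDr x y z t :
  dotp z (fun i => y i + t * x i) = dotp z y + t * dotp z x.
Proof. by rewrite dotpC dotpDl (dotpC y) (dotpC x). Qed.

Lemma mxappD A x y t :
  mxapp A (fun i => y i + t * x i) = fun i => mxapp A y i + t * mxapp A x i.
Proof.
apply/funext => i; rewrite /mxapp mulr_sumr -big_split /=.
by apply: eq_bigr => j _; ring.
Qed.

Lemma form_combE A x y t : A^T = A ->
  dotp (fun i => y i + t * x i) (mxapp A (fun i => y i + t * x i)) =
  dotp y (mxapp A y) + 2 * t * dotp x (mxapp A y)
  + t ^+ 2 * dotp x (mxapp A x).
Proof.
move=> symA; rewrite mxappD dotpDl !dotpDr (mxapp_sym y x symA).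
by rewrite (dotpC (mxapp A y)); ring.
Qed.

Lemma dotp_combE x y t :
  dotp (fun i => y i + t * x i) (fun i => y i + t * x i) =
  dotp y y + 2 * t * dotp x y + t ^+ 2 * dotp x x.
Proof. by rewrite dotpDl !dotpDr (dotpC y x); ring. Qed.

(* With [d = A y - M y], the quadratic
   [t |-> M |y + t d|^2 - <y + t d, A (y + t d)>] is nonnegative and at most 0 at
   [t = 0], so its linear coefficient [-2 |d|^2] vanishes. *)
Lemma rayleigh_max_eigen A M y : A^T = A ->
    (forall x, dotp x (mxapp A x) <= M * dotp x x) ->
    M * dotp y y <= dotp y (mxapp A y) ->
  forall i, mxapp A y i = M * y i.
Proof.
move=> symA ub yM i.
pose d i := mxapp A y i - M * y i.
have dE x : dotp x d = dotp x (mxapp A y) - M * dotp x y.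
  rewrite /dotp mulr_sumr -sumrB; apply: eq_bigr => j _; rewrite /d; ring.
suff /(dotp_eq0 i)/eqP : dotp d d = 0 by rewrite subr_eq0 => /eqP.
set w := dotp d d; pose c := M * dotp d d - dotp d (mxapp A d).
have w0 : 0 <= w by exact: dotp_ge0.
have c0 : 0 <= c by rewrite subr_ge0 ub.
have key t : 2 * t * w <= t ^+ 2 * c.
  have := ub (fun i => y i + t * d i).
  rewrite form_combE // dotp_combE.
  have := dE d; rewrite -/w /c -/w => ->.
  move: (dotp d (mxapp A y)) (dotp d (mxapp A d)) (dotp d y) => u v z.
  move: (t ^+ 2) => t2; nra.
have cp : 0 < 1 + c by lra.
(* For this [t] one has [t * c <= w], so [key] yields [2 * t * w <= t * w], absurd if [w > 0]. The
   summand 1 covers [c = 0]. *)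
have kk := key (w / (1 + c)).
apply/eqP; rewrite eq_le w0 andbT leNgt; apply/negP => wp.
have : 2 * (w / (1 + c)) * w <= w / (1 + c) * w.
  apply: le_trans kk _; rewrite expr2 -mulrA.
  apply: ler_wpM2l; first by rewrite divr_ge0 ?ltW.
  by rewrite [leLHS]mulrAC ler_pdivrMr //; nra.
have : 0 < w / (1 + c) by rewrite divr_gt0.
by move: (w / (1 + c)) => u; nra.
Qed.

Lemma form_scaleE A x a :
  dotp (fun i => a * x i) (mxapp A (fun i => a * x i)) =
  a ^+ 2 * dotp x (mxapp A x).
Proof.
rewrite /dotp mulr_sumr; apply: eq_bigr => i _.
suff -> : mxapp A (fun i => a * x i) i = a * mxapp A x i by ring.
by rewrite /mxapp mulr_sumr; apply: eq_bigr => j _; ring.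
Qed.

Lemma dotp_scaleE x a :
  dotp (fun i => a * x i) (fun i => a * x i) = a ^+ 2 * dotp x x.
Proof. by rewrite /dotp mulr_sumr; apply: eq_bigr => i _; ring. Qed.

Lemma dotp_normalize x i : x i != 0 ->
  exists2 a, 0 < a & dotp (fun j => a * x j) (fun j => a * x j) = 1.
Proof.
move=> /dotp_gt0 xx; exists (Num.sqrt (dotp x x))^-1.
  by rewrite invr_gt0 sqrtr_gt0.
by rewrite dotp_scaleE exprVn sqr_sqrtr ?dotp_ge0 // mulVf // gt_eqF.
Qed.

Lemma mxapp_mul A B x : mxapp (A *m B) x = mxapp A (mxapp B x).
Proof.
apply/funext => i; rewrite /mxapp.
under eq_bigr do rewrite mxE mulr_suml.
under [RHS]eq_bigr do rewrite mulr_sumr.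
rewrite exchange_big /=; apply: eq_bigr => j _; apply: eq_bigr => k _; ring.
Qed.

Lemma mxapp1 x : mxapp 1%:M x = x.
Proof.
apply/funext => i; rewrite /mxapp (bigD1 i) //= mxE eqxx mul1r big1 ?addr0 //.
by move=> j ji; rewrite mxE eq_sym (negbTE ji) mul0r.
Qed.

(** Each |x_i x_j| is at most |x|^2, so the sum of all |A_ij| bounds the form; adding 1 keeps the
    constant positive when A = 0. *)
Lemma form_le_scale A : exists2 C, 0 < C &
  forall x, dotp x (mxapp A x) <= C * dotp x x.
Proof.
exists (1 + \sum_i \sum_j `|A i j|) => [|x].
  by rewrite ltr_pwDl // sumr_ge0 // => i _; rewrite sumr_ge0.
apply: (@le_trans _ _ ((\sum_i \sum_j `|A i j|) * dotp x x)); last first.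
  by rewrite ler_wpM2r ?dotp_ge0 // lerDr.
have sqr_le i : x i ^+ 2 <= dotp x x.
  rewrite /dotp (bigD1 i) //= -expr2 lerDl sumr_ge0 // => j _.
  by rewrite -expr2 sqr_ge0.
rewrite mulr_suml; apply: ler_sum => i _.
rewrite /mxapp mulr_sumr mulr_suml; apply: ler_sum => j _.
apply: le_trans (ler_norm _) _.
rewrite (_ : x i * _ = A i j * (x i * x j)); last by ring.
rewrite normrM ler_wpM2l // ler_norml; apply/andP.
have := sqr_le i; have := sqr_le j; have := sqr_ge0 (x i + x j).
have := sqr_ge0 (x i - x j); move: (dotp x x) (x i) (x j) => d a b.
by rewrite !expr2; split; lra.
Qed.

(* Let [M] be the supremum of [A] on the unit sphere.  If [B = M - A] were
   invertible, then [0 <= <y - K x, B (y - K x)>] with [y = B^-1 x] and [K] a bound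
   of [B^-1] would give [<x, B x> >= 1 / K] on the sphere, so that [M - 1 / K]
   would be an upper bound as well. *)
Lemma rayleigh_max A : (0 < n)%N -> A^T = A -> exists M y,
  [/\ dotp y y = 1, dotp y (mxapp A y) = M &
  forall x, dotp x (mxapp A x) <= M * dotp x x].
Proof.
move=> n0 symA.
pose E := [set a | exists2 x, dotp x x = 1 & dotp x (mxapp A x) = a]%classic.
have E0 : (E !=set0)%classic.
  have [|a _ a1] := @dotp_normalize (fun=> 1) (Ordinal n0); first exact: oner_neq0.
  by eexists; exists (fun j => a * 1).
have ubE : has_ubound E.
  have [C _ leC] := form_le_scale A; exists C => _ [x x1 <-].
  by have := leC x; rewrite x1 mulr1.
pose M := sup E.
have leM x : dotp x (mxapp A x) <= M * dotp x x.
  have [[i xi]|x0] := pselect (exists i, x i != 0); last first.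
    have {}x0 i : x i = 0 by apply/eqP/negPn/negP => xi; apply: x0; exists i.
    have dx0 z : dotp x z = 0 by apply: big1 => i _; rewrite x0 mul0r.
    by rewrite !dx0 mulr0.
  have [a a0 a1] := dotp_normalize xi.
  have : dotp (fun j => a * x j) (mxapp A (fun j => a * x j)) <= M.
    by apply: ub_le_sup => //; exists (fun j => a * x j).
  rewrite form_scaleE; move: a1; rewrite dotp_scaleE => a1 le_M.
  by rewrite -(ler_pM2l (exprn_gt0 2 a0)) [leRHS]mulrCA a1 mulr1.
pose B := M%:M - A.
have BE x i : mxapp B x i = M * x i - mxapp A x i.
  rewrite -{2}[x]mxapp1 /mxapp mulr_sumr -sumrB; apply: eq_bigr => j _.
  by rewrite !mxE -mulr_natr; ring.
have symB : B^T = B by rewrite /B linearB /= tr_scalar_mx symA.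
have formB x : dotp x (mxapp B x) = M * dotp x x - dotp x (mxapp A x).
  rewrite /dotp mulr_sumr -sumrB; apply: eq_bigr => i _; rewrite BE; ring.
exists M; have [uB|] := boolP (B \in unitmx); last first.
  (* A singular [B] has a kernel vector, and once normalized it attains [M]. *)
  rewrite unitmxE unitfE negbK => /det0P[v v0 vB].
  have [i vi] : exists i, v ord0 i != 0.
    apply: contrapT => nv; case/eqP: v0; apply/rowP => i; rewrite mxE.
    by apply/eqP/negPn/negP => vi; apply: nv; exists i.
  have Bv : mxapp B (v ord0) = fun=> 0.
    apply/funext => j; have /rowP/(_ j) := vB; rewrite !mxE => vBj.
    rewrite -[RHS]vBj; apply: eq_bigr => k _.
    by rewrite -{1}symB mxE mulrC.
  have [a _ a1] := dotp_normalize vi.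
  exists (fun j => a * v ord0 j); split=> //.
  apply/eqP; rewrite -subr_eq0 -oppr_eq0 opprB -{1}[M]mulr1 -a1 -formB.
  rewrite form_scaleE Bv /dotp big1 ?mulr0 // => j _; exact: mulr0.
have [K K0 leK] := form_le_scale (invmx B).
suff : M <= M - K^-1 by rewrite lerBrDr gerDl leNgt invr_gt0 K0.
apply: ge_sup => // _ [x x1 <-].
pose y := mxapp (invmx B) x.
have By : mxapp B y = x by rewrite /y -mxapp_mul mulmxV // mxapp1.
have := formB (fun i => y i + (- K) * x i).
rewrite form_combE // By x1 => pos.
have yx : dotp y x <= K by have := leK x; rewrite x1 mulr1 dotpC.
have Bx := formB x; rewrite x1 mulr1 in Bx.
rewrite lerBrDl -lerBrDr -Bx.
have : 0 <= dotp y x + 2 * - K * 1 + (- K) ^+ 2 * dotp x (mxapp B x).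
  by rewrite pos subr_ge0 leM.
move=> h; rewrite -[K^-1]mul1r ler_pdivrMr // -subr_ge0 -(pmulr_rge0 _ K0).
move: h yx; rewrite sqrrN; move: (dotp x (mxapp B x)) (dotp y x) => c d.
by rewrite expr2; lra.
Qed.

End SymmetricForms.

(** * Perron theory of A_sigma *)

Section GraphSpectrum.
Variables (R : realType) (sigma : R).
Hypotheses (sigma_ge0 : 0 <= sigma) (sigma_lt1 : sigma < 1).

Let s_gt0 : 0 < 1 - sigma. Proof. by rewrite subr_gt0. Qed.

(** The degree term is distributed over the edges at [i]: for nonnegative [x] every edge contributes
    a nonnegative summand, which allows comparing graphs edge by edge. *)
Definition Aop n (G : sgraph n) (x : 'I_n -> R) (i : 'I_n) : R :=
  \sum_(j | adj G i j) (sigma * x i + (1 - sigma) * x j).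

Lemma A_mx_sym n (G : sgraph n) : (A_mx sigma G)^T = A_mx sigma G.
Proof.
apply/matrixP => i j; rewrite !mxE adj_sym.
by case: eqVneq => [->|]; rewrite ?eqxx ?mulr0n.
Qed.

Lemma mxapp_A_mx n (G : sgraph n) (x : 'I_n -> R) :
  mxapp (A_mx sigma G) x = Aop G x.
Proof.
apply/funext => i; rewrite /mxapp /Aop big_split /= sumr_const.
have -> : #|[pred j | adj G i j]| = degree G i by rewrite /degree cardsE.
rewrite (eq_bigr (fun j => sigma * (degree G i)%:R * (j == i)%:R * x j +
   (if adj G i j then (1 - sigma) * x j else 0))) => [|j _].
  rewrite big_split /= -big_mkcond /=; congr (_ + _).
  rewrite (bigD1 i) //= eqxx big1 ?addr0 => [|j /negbTE ->].
    by rewrite mulr1 -mulr_natr; ring.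
  by rewrite mulr0 mul0r.
rewrite !mxE eq_sym; case: eqVneq => _; case: (adj G i j);
  rewrite ?mulr0n ?mulr1n ?mulr0 ?mulr1; try ring.
Qed.

Lemma Aop_sym n (G : sgraph n) (x y : 'I_n -> R) :
  dotp x (Aop G y) = dotp (Aop G x) y.
Proof.
by rewrite -(mxapp_A_mx G x) -(mxapp_A_mx G y) (mxapp_sym _ _ (A_mx_sym G)).
Qed.

(** The Rayleigh maximum is an eigenvalue by [rayleigh_max_eigen], and it bounds every eigenvalue,
    as seen by evaluating the form at an eigenvector. So it is the supremum defining
    [spectral_radius]. *)
Lemma spectral_radius_max n (G : sgraph n) : (0 < n)%N -> exists y,
  [/\ dotp y y = 1, dotp y (Aop G y) = spectral_radius sigma G
    & forall x, dotp x (Aop G x) <= spectral_radius sigma G * dotp x x].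
Proof.
move=> n0; have [M [y [y1 yM maxM]]] := rayleigh_max n0 (A_mx_sym G).
suff <- : M = spectral_radius sigma G.
  by exists y; split=> // [|x]; rewrite -mxapp_A_mx.
have eigE a (v : 'rV[R]_n) : (v *m A_mx sigma G = a *: v) <->
    forall i, mxapp (A_mx sigma G) (v ord0) i = a * v ord0 i.
  have vE i : (v *m A_mx sigma G) ord0 i = mxapp (A_mx sigma G) (v ord0) i.
    rewrite mxE; apply: eq_bigr => j _.
    by rewrite -{1}[A_mx _ _]A_mx_sym mxE mulrC.
  split=> [/matrixP E i|E]; first by rewrite -vE E mxE.
  by apply/rowP => i; rewrite vE E mxE.
have ubM : ubound [set a : R | eigenvalue (A_mx sigma G) a]%classic M.
  move=> a /= /eigenvalueP[v /eigE va v0].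
  have [i vi] : exists i, v ord0 i != 0.
    apply: contrapT => nv; case/eqP: v0; apply/rowP => i; rewrite mxE.
    by apply/eqP/negPn/negP => vi; apply: nv; exists i.
  have := maxM (v ord0); rewrite (_ : mxapp _ _ = fun i => a * v ord0 i).
    rewrite (_ : dotp _ _ = a * dotp (v ord0) (v ord0)).
      by rewrite ler_pM2r // (dotp_gt0 vi).
    by rewrite /dotp mulr_sumr; apply: eq_bigr => j _; ring.
  exact/funext.
have Ma : [set a : R | eigenvalue (A_mx sigma G) a]%classic M.
  apply/eigenvalueP; exists (\row_i y i).
    apply/eigE => i.
    rewrite (_ : (\row_i y i) ord0 = y); last first.
      by apply/funext => j; rewrite mxE.
    by apply: rayleigh_max_eigen => //; rewrite ?A_mx_sym // yM y1 mulr1.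
  apply/eqP => /rowP y0; move: y1; rewrite /dotp big1 => [/esym/eqP|i _].
    by rewrite oner_eq0.
  by have := y0 i; rewrite !mxE => ->; rewrite mul0r.
apply/eqP; rewrite eq_le; apply/andP; split.
  by apply: ub_le_sup => //; exists M.
by apply: ge_sup => //; exists M.
Qed.

Lemma rayleigh_le n (G : sgraph n) x :
  dotp x (Aop G x) <= spectral_radius sigma G * dotp x x.
Proof.
case: n G x => [|n] G x; first by rewrite /dotp !big_ord0 mulr0.
by have [y [_ _ ->]] := spectral_radius_max G (ltn0Sn n).
Qed.

Lemma rayleigh_eq_eigen n (G : sgraph n) x :
  spectral_radius sigma G * dotp x x <= dotp x (Aop G x) ->
  forall i, Aop G x i = spectral_radius sigma G * x i.
Proof.
rewrite -mxapp_A_mx => xmax; apply: rayleigh_max_eigen => // [|y].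
  exact: A_mx_sym.
by rewrite mxapp_A_mx rayleigh_le.
Qed.

(** At a zero of [x] the eigenvalue equation is a vanishing sum of nonnegative terms, so all
    neighbours are zeros too, and connectedness spreads this to the whole graph. *)
Lemma nonneg_eigen_pos n (G : sgraph n) (x : 'I_n -> R) l i :
    connected_graph G -> (forall j, 0 <= x j) -> x i != 0 ->
    (forall j, Aop G x j = l * x j) ->
  forall j, 0 < x j.
Proof.
move=> Gc x0 xi xl j; rewrite lt_neqAle x0 andbT eq_sym.
apply/negP => /eqP xj; case/eqP: xi.
suff cl : closed_mem (adj G) (mem [pred k | x k == 0]).
  by apply/eqP; have := closed_connect cl (Gc i j); rewrite !inE xj eqxx.
suff imp k k' : adj G k k' -> x k == 0 -> x k' == 0.
  by move=> k k' kk'; apply/idP/idP; apply: imp; rewrite // adj_sym.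
move=> kk' /eqP xk; have := xl k; rewrite xk mulr0 /Aop.
move/eqP; rewrite psumr_eq0 => [|m _]; last first.
  by rewrite xk mulr0 add0r mulr_ge0 // ltW.
move=> /allP /(_ k'); rewrite mem_index_enum kk' xk mulr0 add0r => /(_ isT).
by rewrite mulf_eq0 gt_eqF.
Qed.

(** Taking absolute values of a maximizer does not decrease the form, since the off-diagonal entries
    are nonnegative. *)
Lemma Perron_vector n (G : sgraph n) : (0 < n)%N -> connected_graph G ->
  exists w : 'I_n -> R, (forall i, 0 < w i) /\
    forall i, Aop G w i = spectral_radius sigma G * w i.
Proof.
move=> n0 Gc; have [y [y1 yl _]] := spectral_radius_max G n0.
pose w i := `|y i|.
have ww : dotp w w = 1.
  by rewrite -y1; apply: eq_bigr => i _; rewrite -normrM ger0_norm // -expr2 sqr_ge0.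
have [i wi] : exists i, w i != 0.
  apply: contrapT => nw; have /eqP := ww.
  rewrite /dotp big1 ?(eq_sym 0) ?oner_eq0 //.
  move=> i _; suff -> : w i = 0 by rewrite mul0r.
  by apply/eqP/negPn/negP => wi; apply: nw; exists i.
have wl : forall i, Aop G w i = spectral_radius sigma G * w i.
  apply: rayleigh_eq_eigen; rewrite ww mulr1 -yl; apply: ler_sum => j _.
  rewrite /Aop !mulr_sumr; apply: ler_sum => k _.
  apply: le_trans (ler_norm _) _; rewrite normrM ler_wpM2l //.
  apply: le_trans (ler_normD _ _) _; rewrite !normrM (ger0_norm sigma_ge0).
  by rewrite (gtr0_norm s_gt0).
by exists w; split=> //; apply: nonneg_eigen_pos wi wl => // j; rewrite normr_ge0.
Qed.

(** A Collatz-Wielandt bound: pairing the inequalities for [z] with the positive Perron vector [w]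
    gives lambda <z, w> = <A z, w> < l <z, w>. *)
Lemma spectral_radius_lt n (G : sgraph n) (z : 'I_n -> R) l i :
    connected_graph G -> (forall j, 0 < z j) ->
    (forall j, Aop G z j <= l * z j) -> Aop G z i < l * z i ->
  spectral_radius sigma G < l.
Proof.
move=> Gc z0 zl zi.
have [w [w0 wl]] := Perron_vector (leq_ltn_trans (leq0n i) (ltn_ord i)) Gc.
have zw0 : 0 < dotp z w.
  rewrite /dotp (bigD1 i) //= ltr_wpDr ?mulr_gt0 // sumr_ge0 // => j _.
  by rewrite mulr_ge0 // ltW.
rewrite -(ltr_pM2r zw0).
have -> : spectral_radius sigma G * dotp z w = dotp (Aop G z) w.
  rewrite -Aop_sym /dotp mulr_sumr; apply: eq_bigr => j _; rewrite wl; ring.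
rewrite /dotp mulr_sumr (bigD1 i) //= [ltRHS](bigD1 i) //= ltr_leD //.
  by rewrite mulrA ltr_pM2r.
by apply: ler_sum => j _; rewrite mulrA ler_pM2r.
Qed.

(** Extend [x] by zero to [X] on [H]. Then l |x|^2 <= <x, A(K) x> <= <X, A(H) X> <= lambda(H) |x|^2
    <= l |x|^2, so equality holds throughout and [X] is an eigenvector of [H], hence positive. A
    vertex outside the image or an additional edge would contradict this. *)
Lemma embed_rigid m n (K : sgraph m) (H : sgraph n) (f : 'I_m -> 'I_n)
    (x : 'I_m -> R) l i0 :
    connected_graph H -> injective f ->
    (forall i j, adj K i j -> adj H (f i) (f j)) ->
    (forall i, 0 <= x i) -> x i0 != 0 ->
    l * dotp x x <= dotp x (Aop K x) -> spectral_radius sigma H <= l ->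
  [/\ spectral_radius sigma H = l, bijective f,
      forall i j, adj H (f i) (f j) = adj K i j
    & forall i, Aop K x i = l * x i].
Proof.
move=> Hc injf homf x0 xi0 xl Hl.
pose X v := \sum_(i | f i == v) x i.
have Xf i : X (f i) = x i.
  by rewrite /X (big_pred1 i) // => j; rewrite /= (inj_eq injf).
have X0 v : 0 <= X v by apply: sumr_ge0.
have dX y : dotp X y = dotp x (fun i => y (f i)).
  rewrite /dotp; under eq_bigr do rewrite mulr_suml.
  rewrite (exchange_big_dep xpredT) //=; apply: eq_bigr => i _.
  by rewrite (big_pred1 (f i)) // => v; rewrite eq_sym.
have XX : dotp X X = dotp x x by rewrite dX; apply: eq_bigr => i _; rewrite Xf.
have xx0 := dotp_gt0 xi0.
(* The part of [Aop H X (f i)] that comes from the edges of [K]. *)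
pose K' i := \sum_(j in f @: [set j | adj K i j])
  (sigma * X (f i) + (1 - sigma) * X j).
have K'E i : K' i = Aop K x i.
  rewrite /K' big_imset /=; last by move=> j k _ _; apply: injf.
  by apply: eq_big => [j|j _]; rewrite ?inE // !Xf.
have K'le i : K' i <= Aop H X (f i).
  rewrite [leRHS]/Aop (bigID (mem (f @: [set j | adj K i j]))) /=.
  rewrite (eq_bigl (mem (f @: [set j | adj K i j]))) => [|v /=].
    by rewrite lerDl sumr_ge0 // => v _; rewrite addr_ge0 // mulr_ge0 // ltW.
  apply: andb_idl => /imsetP[j]; rewrite inE => ij ->; exact: homf.
have le1 : dotp x (Aop K x) <= dotp X (Aop H X).
  by rewrite dX; apply: ler_sum => i _; rewrite ler_wpM2l // -K'E.
have le2 := rayleigh_le H X.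
have le3 : spectral_radius sigma H * dotp x x <= l * dotp x x by rewrite ler_pM2r.
rewrite XX in le2.
have El : spectral_radius sigma H = l.
  apply/eqP; rewrite eq_le Hl -(ler_pM2r xx0); lra.
have eqH : forall v, Aop H X v = l * X v.
  rewrite -El; apply: rayleigh_eq_eigen; rewrite XX El; lra.
have Xpos : forall v, 0 < X v.
  by apply: (nonneg_eigen_pos (i := f i0)) eqH => //; rewrite Xf.
have eqK i : Aop H X (f i) = Aop K x i.
  have /eqP : \sum_i x i * (Aop H X (f i) - Aop K x i) = 0.
    have -> : \sum_i x i * (Aop H X (f i) - Aop K x i)
        = dotp X (Aop H X) - dotp x (Aop K x).
      by rewrite dX /dotp -sumrB; apply: eq_bigr => j _; ring.
    apply/eqP; rewrite eq_le; apply/andP; split; rewrite ?subr_ge0 //; lra.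
  rewrite psumr_eq0 => [|j _]; last first.
    by rewrite mulr_ge0 // -K'E subr_ge0.
  move=> /allP /(_ i); rewrite mem_index_enum => /(_ isT).
  by rewrite /= mulf_eq0 -(Xf i) (gt_eqF (Xpos _)) subr_eq0 => /eqP.
split=> //.
- have surj v : v \in codom f.
    apply: contraT => nv; have := Xpos v; rewrite /X big1 ?ltxx // => i /eqP iv.
    by case/negP: nv; rewrite -iv codom_f.
  exists (fun v => iinv (surj v)) => [i|v]; last exact: f_iinv.
  by apply: injf; rewrite f_iinv.
- move=> i j; apply/idP/idP; last exact: homf.
  move=> ij; apply: contraT => nij.
  have : K' i < Aop H X (f i).
    rewrite [ltRHS]/Aop (bigID (mem (f @: [set j | adj K i j]))) /=.
    rewrite (eq_bigl (mem (f @: [set j | adj K i j]))) => [|v /=].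
      rewrite ltrDl (bigD1 (f j)) /=; last first.
        rewrite ij; apply: contra nij => /imsetP[k]; rewrite inE => ik /injf.
        by move=> ->.
      rewrite ltr_wpDr ?sumr_ge0 // => [v _|].
        by rewrite addr_ge0 // mulr_ge0 // ltW.
      by rewrite ltr_wpDl ?mulr_ge0 // mulr_gt0.
    apply: andb_idl => /imsetP[k]; rewrite inE => ik ->; exact: homf.
  by rewrite K'E eqK ltxx.
- by move=> i; rewrite -eqK eqH Xf.
Qed.

End GraphSpectrum.

(** * Spanning trees and edge counting *)

Section TreeCombinatorics.
Variable n : nat.
Implicit Types (G T : sgraph n) (S X : {set 'I_n}).

(** The lower bound on [size p] keeps a single edge, run through back and forth, from counting as a
    cycle. *)
Definition acyclic T : Prop := forall x p, path (adj T) x p ->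
  uniq (x :: p) -> (2 <= size p)%N -> ~~ adj T x (last x p).

(** A minimal symmetric edge set that still connects all vertices is acyclic: the closing edge of a
    cycle could be removed, the rest of the cycle being a detour. *)
Lemma spanning_tree G : connected_graph G -> exists T,
  [/\ subrel (adj T) (adj G), connected_graph T & acyclic T].
Proof.
move=> Gc; pose rl (E : {set 'I_n * 'I_n}) : rel 'I_n := fun u v => (u, v) \in E.
pose P (E : {set 'I_n * 'I_n}) :=
  [forall x, forall y, rl E x y == rl E y x] &&
  [forall x, forall y, connect (rl E) x y].
pose E0 := [set e | adj G e.1 e.2].
have PE0 : P E0.
  apply/andP; split; apply/forallP => x; apply/forallP => y.
    by rewrite /rl !inE /= adj_sym.
  rewrite (@eq_connect _ _ (adj G)) // => u v; by rewrite /rl inE.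
have [E /minsetP[PE minE] EE0] := minset_exists PE0.
have /andP[/forallP symE /forallP cE] := PE.
have symT : symmetric (rl E) by move=> x y; apply/eqP; move/forallP: (symE x).
have subT : subrel (rl E) (adj G).
  by move=> x y xy; have := subsetP EE0 _ xy; rewrite inE.
have irrT : irreflexive (rl E).
  by move=> x; apply/negP => /subT; rewrite adj_irr.
exists (SGraph symT irrT); split=> //= [x y|x p].
  by move/forallP: (cE x); apply.
move=> pathp; set y := last x p => up szp; apply/negP => xy.
have := minE (E :\: [set (x, y); (y, x)]) _ (subsetDl _ _).
set E' := E :\: _.
suff PE' : P E'.
  by move=> /(_ PE') EE; move: (xy : (x, y) \in E); rewrite -EE !inE eqxx.
have symE' u v : rl E' u v = rl E' v u.
  rewrite /rl !inE !xpair_eqE -/(rl E u v) -/(rl E v u) (symT u v) /=.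
  by rewrite orbC ![(u == _) && _]andbC.
(* The path [p] avoids the removed edge: its first step leads to [z != y], and the later steps never
   meet [x]. *)
have cxy : connect (rl E') x y.
  apply/connectP; exists p => //.
  case: p => // z [|t p] // in pathp y up szp xy E' symE' *.
  have /andP[xz pz] : rl E x z && path (rl E) z (t :: p) by [].
  have yt : y \in t :: p by rewrite /y /= mem_last.
  have zy : z != y.
    by apply: contraTneq up => ->; rewrite /= yt !andbF.
  have xnz : x \notin [:: z, t & p] by case/andP: up.
  have nxz : x != z by apply: contraNneq xnz => ->; rewrite mem_head.
  apply/andP; split.
    rewrite /rl !inE !xpair_eqE -/(rl E x z) xz andbT.
    by rewrite (negbTE zy) [z == x]eq_sym (negbTE nxz) !andbF.
  apply: (@sub_in_path _ (predC1 x) (rl E)) pz => [u v|].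
    rewrite !inE => ux vx uv.
    by rewrite /rl !inE !xpair_eqE (negbTE ux) (negbTE vx) andbF.
  by apply/allP => u uin; apply: contraNneq xnz => <-.
apply/andP; split; apply/forallP => u; apply/forallP => v; first by rewrite symE'.
have : connect (rl E) u v by move/forallP: (cE u); apply.
apply: connect_sub => {u v} u v uv.
have [|uvE'] := boolP (rl E' u v); first exact: connect1.
move: uvE'; rewrite /rl !inE -/(rl E u v) uv andbT negbK.
case/orP => /eqP[-> ->] //.
by rewrite (sym_connect_sym symE').
Qed.

Lemma boundary_edge T X x : connected_graph T -> x \in X -> X != setT ->
  exists u v, [/\ u \in X, v \notin X & adj T u v].
Proof.
move=> Tc xX; rewrite -subTset => /subsetPn[y _ yX].
have [/existsP[u /existsP[v /and3P[]]]|none] :=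
  boolP [exists u, exists v, [&& u \in X, v \notin X & adj T u v]].
  by exists u, v.
have cl : closed_mem (adj T) (mem X).
  have imp u v : adj T u v -> u \in X -> v \in X.
    move=> uv uX; apply: contraT => vX; case/negP: none.
    by apply/existsP; exists u; apply/existsP; exists v; rewrite uX vX.
  by move=> u v uv; apply/idP/idP; apply: imp; rewrite // adj_sym.
by have := closed_connect cl (Tc x y); rewrite xX (negbTE yX).
Qed.

(** Oriented edges count an edge twice when both its ends avoid [S]. For [X = setT] the number of
    darts is the sum of the degrees outside [S]. *)
Definition covered_darts T S X : {set 'I_n * 'I_n} :=
  [set e | [&& e.1 \in X :\: S, e.2 \in X & adj T e.1 e.2]].

(* Enlarging [X] along a boundary edge adds at least one dart, since an edge
   has an end outside the independent set [S]. *)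
Lemma order_le_covered_darts T S X d : connected_graph T -> independent T S ->
  X != set0 -> (#|X| <= #|covered_darts T S X| + d)%N ->
  (n <= \sum_(v in ~: S) degree T v + d)%N.
Proof.
move=> Tc indS /set0Pn[x xX] Xd.
pose P (Y : {set 'I_n}) := (x \in Y) && (#|Y| <= #|covered_darts T S Y| + d)%N.
have PX : P X by rewrite /P xX.
have [Y /maxsetP[/andP[xY Yd] maxY] _] := maxset_exists PX.
have [YT|YT] := eqVneq Y setT.
  move: Yd; rewrite YT cardsT card_ord; suff -> : #|covered_darts T S setT| =
    \sum_(v in ~: S) degree T v by [].
  rewrite /covered_darts -sum1dep_card.
  rewrite (eq_bigl (fun e => (e.1 \in ~: S) && adj T e.1 e.2)) => [|e]; last first.
    by rewrite !inE !andbT.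
  rewrite -(pair_big_dep (fun v => v \in ~: S) (fun v w => adj T v w)
    (fun _ _ => 1%N)) /=.
  by apply: eq_bigr => v _; rewrite sum1dep_card.
have [u [v [uY vY uv]]] := boundary_edge Tc xY YT.
have indS' : (u \notin S) || (v \notin S).
  rewrite -negb_and; apply/negP => /andP[uS vS].
  by move/forall_inP: indS => /(_ u uS) /forall_inP /(_ v vS); rewrite uv.
suff PY : P (v |: Y).
  by move: vY; rewrite -(maxY _ PY (subsetUr _ _)) setU11.
rewrite /P !inE xY orbT /= cardsU1 vY add1n.
apply: leq_ltn_trans Yd _; rewrite ltn_add2r.
apply/proper_card/properP; split.
  apply/subsetP => -[a b]; rewrite !inE /= => /and3P[/andP[-> ->] -> ->].
  by rewrite !orbT.
have [uS|uS] := boolP (u \in S).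
  exists (v, u); rewrite !inE /= ?(negbTE vY) ?andbF //.
  by rewrite uS /= in indS'; rewrite indS' eqxx uY orbT adj_sym.
exists (u, v); rewrite !inE /= ?(negbTE vY) ?andbF //.
by rewrite uS uY eqxx orbT.
Qed.

Lemma order_le_degree_sum T S : connected_graph T -> independent T S ->
  (n <= (\sum_(v in ~: S) degree T v).+1)%N.
Proof.
move=> Tc indS; case: (posnP n) => [n0|n0]; first by rewrite [leqLHS]n0.
rewrite -addn1; apply: (@order_le_covered_darts T S [set Ordinal n0]) => //.
  by apply/set0Pn; exists (Ordinal n0); rewrite inE.
by rewrite cards1 addn1.
Qed.

(** The enlargement starts from an edge lying outside [S], whose two vertices carry two darts; a
    start from one vertex without darts loses 1. *)
Lemma order_le_degree_sum_edge T S a b : connected_graph T -> independent T S ->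
  a \notin S -> b \notin S -> adj T a b ->
  (n <= \sum_(v in ~: S) degree T v)%N.
Proof.
move=> Tc indS aS bS ab; have nab : a != b.
  by apply: contraTneq ab => ->; rewrite adj_irr.
rewrite -[leqRHS]addn0; apply: (@order_le_covered_darts T S [set a; b]) => //.
  by apply/set0Pn; exists a; rewrite !inE eqxx.
rewrite addn0 cards2 nab.
apply: (@leq_trans #|[set (a, b); (b, a)]|).
  by rewrite cards2 xpair_eqE (negbTE nab).
apply/subset_leq_card/subsetP => e; rewrite !inE => /orP[]/eqP-> /=.
  by rewrite aS ab !eqxx orbT.
by rewrite bS adj_sym ab !eqxx orbT.
Qed.

Lemma degree_ge_size T x s : uniq s -> all (adj T x) s -> (size s <= degree T x)%N.
Proof.
move=> us /allP xs; rewrite -(card_uniqP us) /degree.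
by apply/subset_leq_card/subsetP => y /xs; rewrite inE.
Qed.

(** A neighbour of [x] further along the path would close a cycle. *)
Lemma acyclic_head T x p y : acyclic T -> path (adj T) x p -> uniq (x :: p) ->
  adj T x y -> y \in x :: p -> y = head y p.
Proof.
move=> acT pathp up xy; rewrite inE => /orP[/eqP yx|yp].
  by move: xy; rewrite yx adj_irr.
case/splitPr: yp => p1 p2 in pathp up *.
case: p1 => //= z p1 in pathp up *.
have p1path : path (adj T) x (z :: rcons p1 y).
  rewrite -cat_rcons in pathp; move: pathp.
  rewrite -[_ && _]/(path (adj T) x ((z :: rcons p1 y) ++ p2)).
  by rewrite cat_path => /andP[].
have up1 : uniq (x :: z :: rcons p1 y).
  rewrite -cat_rcons in up; move: up.
  by rewrite -[_ && _]/(uniq ((x :: z :: rcons p1 y) ++ p2)) cat_uniq => /andP[].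
have := acT x _ p1path up1; rewrite /= size_rcons last_rcons xy.
by move=> /(_ isT).
Qed.

Lemma no_4cycle T a b c x : acyclic T -> adj T c a -> adj T a x -> adj T x b ->
  adj T b c -> c != x -> a != b -> False.
Proof.
move=> acT ca ax xb bc cx ab.
have ne u v : adj T u v -> u != v.
  by move=> uv; apply: contraTneq uv => ->; rewrite adj_irr.
have := acT c [:: a; x; b]; rewrite /= ca ax xb !inE !negb_or.
rewrite (ne _ _ ca) (ne _ _ ax) (ne _ _ xb) cx ab eq_sym (ne _ _ bc).
by rewrite adj_sym bc => /(_ isT isT isT).
Qed.

End TreeCombinatorics.

(** * Subgraphs of trees with a large independence number *)

Definition embeds m n (K : sgraph m) (G : sgraph n) : Prop :=
  exists f : 'I_m -> 'I_n,
    injective f /\ forall i j, adj K i j -> adj G (f i) (f j).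

(** The star K_{1,4} centred at 0, the affine D4; [graph_of_rel] discards the loop at 0. *)
Definition star5 : sgraph 5 := graph_of_rel 5 (fun x _ => x == 0%N).

(* The tree with one vertex of degree 3, numbered 3, and arms of 3, 3 and 1
   vertices; as a Dynkin diagram it is the affine E7. *)
Definition spider133 : sgraph 8 := graph_of_rel 8 (fun x y =>
  (y == x.+1) && (y < 7)%N || (x == 3%N) && (y == 7%N)).

Section TreeStructure.
Variable n : nat.
Implicit Types (G T : sgraph n) (S X : {set 'I_n}).

Lemma embeds_seq G (r : rel nat) (s : seq 'I_n) x0 : uniq s ->
  (forall i j, i != j -> (i < size s)%N -> (j < size s)%N -> r i j ->
    adj G (nth x0 s i) (nth x0 s j)) ->
  embeds (graph_of_rel (size s) r) G.
Proof.
move=> us rs; exists (fun i => nth x0 s i); split=> [i j /eqP|i j].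
  by rewrite nth_uniq // => /eqP /val_inj.
case/andP=> ij /orP[] /rs; first by apply.
by rewrite adj_sym eq_sym in ij *; apply.
Qed.

Lemma star5_embeds G x : (4 <= degree G x)%N -> embeds star5 G.
Proof.
move=> dx; pose s := take 4 (enum [set y | adj G x y]).
have sz : size s = 4 by rewrite size_takel // -cardE.
have xs y : y \in s -> adj G x y.
  by move=> /mem_take; rewrite mem_enum inE.
have us : uniq (x :: s).
  rewrite /= take_uniq ?enum_uniq // andbT.
  by apply/negP => /xs; rewrite adj_irr.
suff : embeds (graph_of_rel (size (x :: s)) (fun i _ => i == 0%N)) G.
  by rewrite /= sz.
apply: (@embeds_seq G _ _ x us) => i j ij _ js /eqP i0.
move: ij js; rewrite {}i0; case: j => // j _ js /=.
by apply/xs/mem_nth.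
Qed.

Lemma path_nth T x0 x p i : path (adj T) x p -> (i < size p)%N ->
  adj T (nth x0 (x :: p) i) (nth x0 (x :: p) i.+1).
Proof. by move=> /(pathP x0); apply. Qed.

(** A path from [u] to [v] and two further neighbours of each end form a W_m. Acyclicity puts these
    four vertices off the path and makes them distinct. *)
Lemma two_branch_vertices T u v : connected_graph T -> acyclic T -> u != v ->
    (3 <= degree T u)%N -> (3 <= degree T v)%N ->
  exists2 m, (6 <= m)%N & embeds (W_graph m) T.
Proof.
move=> Tc acT uv du dv.
have /connectP[p0 p0path v_last] := Tc u v.
case/shortenP: p0path v_last => p ppath up _ vlast.
have ne x y : adj T x y -> x != y.
  by move=> xy; apply: contraTneq xy => ->; rewrite adj_irr.
have two x q : path (adj T) x q -> uniq (x :: q) -> (3 <= degree T x)%N ->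
    exists a b, [/\ adj T x a, adj T x b, a != b, a \notin x :: q & b \notin x :: q].
  move=> qpath uq dx.
  have /card_gt1P[a [b [aN bN ab]]] :
      (1 < #|[set y | adj T x y] :\ head x q|)%N.
    rewrite -ltnS (leq_trans dx) // /degree.
    by rewrite (cardsD1 (head x q)) -[leqRHS]add1n leq_add2r leq_b1.
  exists a, b; move: aN bN; rewrite !inE => /andP[ah xa] /andP[bh xb].
  have no y : y != head x q -> adj T x y -> y \notin x :: q.
    move=> yh xy; apply: contra yh => yq.
    have yx : y != x by rewrite eq_sym ne.
    rewrite {1}(acyclic_head acT qpath uq xy yq).
    by case: (q) yq yx => //=; rewrite inE => ->.
  by split=> //; apply: no.
have [a1 [a2 [ua1 ua2 a12 a1p a2p]]] := two _ _ ppath up du.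
have prev : path (adj T) v (rev (belast u p)).
  rewrite vlast rev_path; apply: sub_path ppath => x y; by rewrite adj_sym.
have revE : v :: rev (belast u p) = rev (u :: p).
  by rewrite [u :: p]lastI rev_rcons -vlast.
have urev : uniq (v :: rev (belast u p)) by rewrite revE rev_uniq.
have [b1 [b2 [vb1 vb2 b12]]] := two _ _ prev urev dv.
rewrite revE !mem_rev => b1p b2p.
have disj a b : adj T u a -> adj T v b -> a \notin u :: p -> b \notin u :: p ->
    a != b.
  move=> ua vb ap bp; apply: contraTneq ua => ab; rewrite ab.
  have := acT u (rcons p b); rewrite rcons_path ppath -vlast vb last_rcons.
  rewrite -rcons_cons rcons_uniq bp up size_rcons; apply => //.
  by case: (p) vlast uv => // ->; rewrite eqxx.
(* The order follows the numbering of [W_graph]: the path from [a1] to [b1] first, then the pendant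
   vertices [a2] at [u] and [b2] at [v]. *)
pose s := a1 :: u :: p ++ [:: b1; a2; b2].
exists (size s).
  rewrite /s /= size_cat /= !addnS addn0.
  by case: (p) vlast uv => // ->; rewrite eqxx.
apply: (@embeds_seq T _ s u) => [|i j].
  rewrite /s -cat_cons.
  move: (u :: p) up a1p a2p b1p b2p disj => q uq a1q a2q b1q b2q disj.
  rewrite cons_uniq mem_cat negb_or a1q cat_uniq uq /= !inE !negb_or.
  rewrite a2q b1q b2q a12 b12 (disj a1 b1) // (disj a1 b2) // (disj a2 b2) //.
  by rewrite eq_sym (disj a2 b1).
have szs : size s = (size p + 5)%N by rewrite /s /= size_cat /= !addnS addn0.
have apath : path (adj T) a1 (u :: p ++ [:: b1]).
  by rewrite /= adj_sym ua1 cat_path ppath -vlast /= vb1.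
have sE : s = (a1 :: u :: p ++ [:: b1]) ++ [:: a2; b2].
  by rewrite /s /= -catA.
have sz1 : size (a1 :: u :: p ++ [:: b1]) = (size p + 3)%N.
  by rewrite /= size_cat /= !addnS addn0.
rewrite szs => _ is_ js /or3P[/andP[/eqP -> jlt]|/andP[/eqP-> /eqP->]|].
- rewrite sE !nth_cat sz1.
  have -> : (i < size p + 3)%N by clear -jlt; lia.
  have -> : (i.+1 < size p + 3)%N by clear -jlt; lia.
  apply: path_nth apath _; rewrite -addnBA // in jlt.
  by rewrite /= size_cat /= addn1 -ltnS -addn3.
- have -> : (size p + 5 - 2)%N = (size p + 3)%N by clear; lia.
  rewrite sE !nth_cat sz1 ltnn subnn /=.
  by have -> : (1 < size p + 3)%N by clear; lia.
- case/andP => /eqP-> /eqP->.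
  have -> : (size p + 5 - 4)%N = (size p).+1 by clear; lia.
  have -> : (size p + 5 - 1)%N = (size p + 4)%N by clear; lia.
  rewrite sE !nth_cat sz1.
  have -> : ((size p).+1 < size p + 3)%N by clear; lia.
  have -> : (size p + 4 < size p + 3)%N = false by clear; lia.
  have -> : (size p + 4 - (size p + 3))%N = 1 by clear; lia.
  by rewrite /= -cat_cons nth_cat /= ltnSn -last_nth -vlast.
Qed.

End TreeStructure.

(** * Trees with a single vertex of degree 3 *)

Section SingleBranchVertex.
Variable n : nat.
Implicit Types (T : sgraph n) (S : {set 'I_n}).

Lemma exists_other_nbr T x y : (2 <= degree T x)%N -> exists2 z, adj T x z & z != y.
Proof.
move=> dx; have /card_gt0P[z] : (0 < #|[set w | adj T x w] :\ y|)%N.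
  by rewrite -(ltn_add2l (y \in [set w | adj T x w])) -cardsD1
    (leq_ltn_trans _ dx) // addn0 leq_b1.
by rewrite !inE => /andP[zy xz]; exists z.
Qed.

(** Membership in [S] separates the two sides of the spider. Within a side, a coincidence not
    excluded by hypothesis would create a cycle of length 4, or of length 6 in the case
    [a3 = b3]. *)
Lemma spider133_embeds T S c a b d a2 a3 b2 b3 : acyclic T ->
  [/\ adj T c a, adj T c b & adj T c d] -> [/\ a != b, a != d & b != d] ->
  [/\ adj T a a2, adj T a2 a3, adj T b b2 & adj T b2 b3] ->
  [/\ a2 != c, b2 != c, a3 != a & b3 != b] ->
  [/\ a \in S, b \in S, d \in S, a3 \in S & b3 \in S] ->
  [/\ c \notin S, a2 \notin S & b2 \notin S] ->
  embeds spider133 T.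
Proof.
move=> acT [ca cb cd] [ab ad bd] [aa2 a23 bb2 b23] [a2c b2c a3a b3b].
move=> [aS bS dS a3S b3S] [cS a2S b2S].
have nb (x y : 'I_n) : x != y -> ((x == y) = false) * ((y == x) = false).
  by move=> /negbTE xy; rewrite [y == x]eq_sym.
have nf (x y : 'I_n) : x \in S -> y \notin S ->
    ((x == y) = false) * ((y == x) = false).
  by move=> xS yS; apply: nb; apply: contraNneq yS => <-.
have F1 := (nf _ _ aS cS, nf _ _ aS a2S, nf _ _ aS b2S, nf _ _ bS cS,
  nf _ _ bS a2S, nf _ _ bS b2S, nf _ _ dS cS, nf _ _ dS a2S, nf _ _ dS b2S).
have F2 := (nf _ _ a3S cS, nf _ _ a3S a2S, nf _ _ a3S b2S, nf _ _ b3S cS,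
  nf _ _ b3S a2S, nf _ _ b3S b2S).
have F3 := (nb _ _ ab, nb _ _ ad, nb _ _ bd, nb _ _ a2c, nb _ _ b2c,
  nb _ _ a3a, nb _ _ b3b).
have sy x y : adj T x y -> adj T y x by rewrite adj_sym.
have no4 := no_4cycle acT.
have a2b2 : a2 != b2.
  apply/eqP => E; rewrite -E in bb2.
  by apply: (no4 a b c a2) => //; [apply: sy|apply: sy|rewrite eq_sym].
have a3n x : adj T c x -> a != x -> a3 != x.
  move=> cx ax; apply/eqP => E; rewrite E in a23.
  by apply: (no4 a x c a2) => //; [apply: sy|rewrite eq_sym].
have b3n x : adj T c x -> b != x -> b3 != x.
  move=> cx bx; apply/eqP => E; rewrite E in b23.
  by apply: (no4 b x c b2) => //; [apply: sy|rewrite eq_sym].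
have a3b := a3n b cb ab; have a3d := a3n d cd ad.
have b3a : b3 != a by apply: b3n => //; rewrite eq_sym.
have b3d := b3n d cd bd.
have F4 := (nb _ _ a2b2, nb _ _ a3b, nb _ _ a3d, nb _ _ b3a, nb _ _ b3d).
have F := (F1, F2, F3, F4).
have a3b3 : a3 != b3.
  apply/eqP => E; have := acT c [:: a; a2; a3; b2; b].
  rewrite /= ca aa2 a23 {1}E (sy _ _ b23) (sy _ _ bb2) cb /= !inE.
  by rewrite !F => /(_ isT isT isT).
have us : uniq [:: a3; a2; a; c; b; b2; b3; d].
  by rewrite /= !inE !F (nb _ _ a3b3).
apply: (@embeds_seq n T _ _ c us) => i j _ _ _.
case/orP=> [/andP[/eqP-> i7]|/andP[/eqP-> /eqP->] //].
by case: i i7 => [|[|[|[|[|[|i]]]]]] //= _; apply: sy.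
Qed.

(** The arm through [d] is grown until it exhausts the tree. An edge leaving the part found so far
    cannot start at the leaves [a] and [b], at the saturated vertex [c], or inside the arm, so it
    prolongs the arm. *)
Lemma D_graph_embeds T c a b d : connected_graph T -> acyclic T ->
  (4 <= n)%N -> uniq [:: a; b; c; d] ->
  [/\ adj T c a, adj T c b & adj T c d] ->
  degree T c = 3 -> degree T a = 1 -> degree T b = 1 ->
  (forall v, v != c -> (degree T v <= 2)%N) ->
  embeds (D_graph n) T.
Proof.
move=> Tc acT n4 uabcd [ca cb cd] dc da db dle2.
have sy x y : adj T x y -> adj T y x by rewrite adj_sym.
have grow k : (4 + k <= n)%N -> exists p, [/\ size p = k,
    path (adj T) d p & uniq [:: a, b, c, d & p]].
  elim: k => [|k IHk] kn; first by exists [::].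
  have [|p [szp dp up]] := IHk; first by apply: leq_trans kn; rewrite leq_add2l.
  pose X := [set x in [:: a, b, c, d & p]].
  have XT : X != setT.
    apply: contraTneq kn => XT; rewrite -ltnNge addnS ltnS.
    rewrite -[n in (n <= _)%N](card_ord n) -cardsT -XT cardsE.
    by apply: leq_trans (card_size _) _; rewrite /= szp.
  have aX : a \in X by rewrite !inE eqxx.
  have [x [y [xX yX xy]]] := boundary_edge Tc aX XT.
  rewrite !inE !negb_or in yX; case/and5P: yX => ya yb yc yd yp.
  have leaf v : degree T v = 1 -> adj T c v -> x != v.
    move=> dv cv; apply/eqP => xv; rewrite {}xv in xy.
    have := @degree_ge_size n T v [:: c; y]; rewrite dv /= inE eq_sym yc.
    by rewrite (sy _ _ cv) xy => /(_ isT isT).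
  have xa := leaf a da ca; have xb := leaf b db cb.
  have xc : x != c.
    apply/eqP => xc; rewrite {}xc in xy.
    have := @degree_ge_size n T c [:: y; a; b; d]; rewrite dc /= ca cb cd xy.
    rewrite !inE !negb_or ya yb yd; move: uabcd; rewrite /= !inE !negb_or.
    by case/and4P=> /and3P[-> _ ->] /andP[_ ->] _ _ /(_ isT isT).
  have xdp : x \in d :: p.
    by move: xX; rewrite !inE (negbTE xa) (negbTE xb) (negbTE xc).
  have [xlast|xlast] := eqVneq x (last d p).
    exists (rcons p y); rewrite size_rcons szp rcons_path dp -xlast xy.
    split=> //; rewrite -!rcons_cons rcons_uniq up andbT.
    by rewrite !inE !negb_or ya yb yc yd yp.
  have udp : uniq (c :: d :: p) by case/and3P: up.
  have pdp : path (adj T) c (d :: p) by rewrite /= cd dp.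
  have lastE : last d p = last c (d :: p) by [].
  rewrite lastE in xlast; have : y \notin d :: p by rewrite inE negb_or yd.
  case/splitPr: xdp => p1 p2 in udp pdp xlast {lastE} * => yp12.
  case: p2 => [|z p2] in udp pdp xlast yp12 *.
    by rewrite last_cat /= eqxx in xlast.
  (* An inner vertex [x] of the arm would have three neighbours: [y], its successor [z] and its
     predecessor [last c p1]. *)
  have := @degree_ge_size n T x [:: y; z; last c p1] _ _.
  move: pdp; rewrite cat_path /= => /and4P[_ px xz _].
  rewrite xy xz (sy _ _ px) /= !inE !negb_or andbT.
  move=> /(_ _ isT) H; have := dle2 _ xc; rewrite leqNgt => /negP; case; apply: H.
  move: yp12; rewrite mem_cat !inE !negb_or => /and4P[yp1 yx yz _].
  rewrite yz /=; apply/andP; split.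
    by have := mem_last c p1; rewrite inE => /orP[/eqP->//|lp1];
      apply: contraNneq yp1 => ->.
  move: udp; rewrite -cat_cons cat_uniq => /and3P[_ /hasPn /(_ z) H2 _].
  by apply: contraNneq (H2 _) => [->|]; rewrite ?mem_last // !inE eqxx orbT.
have [p [szp dp up]] := grow (n - 4)%N (eq_leq (subnKC n4)).
(* The leaf [b] comes last because [D_graph] numbers its pendant vertex n - 1. *)
pose s := a :: c :: d :: p ++ [:: b].
have szs : size s = n by rewrite /s /= size_cat /= szp addn1 -{2}(subnKC n4).
have perms : perm_eq s [:: a, b, c, d & p].
  rewrite /s perm_cons -(perm_cat2l [::]) /= -!cat_cons cats1.
  by rewrite perm_rcons.
have us : uniq s by rewrite (perm_uniq perms).
suff : embeds (graph_of_rel (size s) (fun x y : nat =>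
    (y == x.+1) && (y < size s - 1)%N ||
    (x == 1%N) && (y == size s - 1)%N)) T by rewrite szs.
apply: (@embeds_seq n T _ _ c us) => i j _ is_ js.
have apath : path (adj T) a (c :: d :: p).
  by rewrite /= (sy _ _ ca) cd dp.
have sE : s = (a :: c :: d :: p) ++ [:: b] by [].
have sz1 : (size s - 1)%N = size (a :: c :: d :: p).
  by rewrite sE size_cat addnK.
rewrite sz1 => /orP[/andP[/eqP-> jlt]|/andP[/eqP-> /eqP->]].
  rewrite sE !nth_cat jlt (ltnW jlt); exact: path_nth.
by rewrite sE !nth_cat ltnn subnn.
Qed.

End SingleBranchVertex.

(** Suppose no degree exceeds 3 and at most one equals 3. Then n - 1 is at most the degree sum
    outside [S], which is at most 2 |V - S| + 1, while |V - S| = n - ceil(n/2) - 1. This forces [n]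
    to be even and every estimate to be an equality, which fixes the shape of the tree around its
    branch vertex. *)
Lemma tree_structure n (T : sgraph n) (S : {set 'I_n}) : (4 <= n)%N ->
    connected_graph T -> acyclic T -> independent T S ->
    #|S| = (uphalf n).+1 ->
  [\/ embeds star5 T, exists2 m, (6 <= m)%N & embeds (W_graph m) T,
      ~~ odd n /\ embeds spider133 T | ~~ odd n /\ embeds (D_graph n) T].
Proof.
move=> n4 Tc acT indS cardS.
have [/existsP[x /star5_embeds]|/existsPn dle3] :=
  boolP [exists x, (4 <= degree T x)%N]; first by constructor 1.
pose B := [set v | (3 <= degree T v)%N].
have [/card_gt1P[u [v [uB vB uv]]]|B1] := ltnP 1 #|B|.
  by constructor 2; rewrite !inE in uB vB; apply: two_branch_vertices uv uB vB.
have degB v : (degree T v <= 2 + (v \in B))%N.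
  have := dle3 v; rewrite -ltnNge ltnS inE.
  by case: ltnP => //; rewrite addn0 ltnS.
have sumB : (\sum_(v in ~: S) (2 + (v \in B)) =
    2 * #|~: S| + #|B :&: ~: S|)%N.
  rewrite big_split /= sum_nat_const mulnC; congr addn.
  rewrite -sum1_card big_mkcond [RHS]big_mkcond /=; apply: eq_bigr => v _.
  by rewrite !inE; do 2 case: ltnP => //=; case: (v \in S).
have eqsum := leqif_sum (fun v (_ : v \in ~: S) => leqif_eq (degB v)).
have nle := order_le_degree_sum Tc indS.
have cardCS : (#|~: S| + (uphalf n).+1 = n)%N.
  by rewrite -cardS addnC cardsC card_ord.
have uph : (uphalf n + uphalf n = n + odd n)%N.
  by rewrite uphalf_half; have := odd_double_half n; rewrite -addnn; lia.
have BS1 : (#|B :&: ~: S| <= 1)%N.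
  by apply: leq_trans B1; apply/subset_leq_card/subsetIl.
rewrite sumB in eqsum.
set D := (\sum_(v in ~: S) degree T v)%N in eqsum nle.
have [le_sum iff_sum] := eqsum.
have nodd : ~~ odd n.
  by case: (odd n) uph => //; clear -nle cardCS BS1 le_sum; lia.
have nD : n = D.+1.
  by clear -nle cardCS BS1 le_sum uph; lia.
have BS : #|B :&: ~: S| = 1%N.
  by clear -nle cardCS BS1 le_sum uph; lia.
have degS v : v \notin S -> degree T v = (2 + (v \in B))%N.
  move=> vS; have : [forall (i | i \in ~: S), degree T i == (2 + (i \in B))%N].
    by rewrite -iff_sum; apply/eqP; clear -nD BS uph nodd cardCS; lia.
  by move=> /forall_inP /(_ v); rewrite inE => /(_ vS) /eqP.
(* An edge with both ends outside [S] would improve the bound to [n <= D]. *)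
have offS x y : adj T x y -> x \notin S -> y \in S.
  move=> xy xS; apply: contraT => yS.
  by have := order_le_degree_sum_edge Tc indS xS yS xy; rewrite -/D {1}nD ltnn.
have inS x y : adj T x y -> x \in S -> y \notin S.
  move=> xy xS; apply/negP => yS.
  by move/forall_inP: indS => /(_ x xS) /forall_inP /(_ y yS); rewrite xy.
have /card_gt0P[c] : (0 < #|B :&: ~: S|)%N by rewrite BS.
rewrite inE => /andP[cB]; rewrite inE => cS.
have dc : degree T c = 3 by rewrite degS // cB.
have dle2 v : v != c -> (degree T v <= 2)%N.
  move=> vc; rewrite leqNgt; apply/negP => dv; move: B1; rewrite leqNgt.
  by case/negP; apply/card_gt1P; exists v, c; rewrite !inE in cB *.
have /card_gt2P[a [b [d [[aN bN dN] [ab bd da]]]]] :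
  (2 < #|[set y | adj T c y]|)%N by rewrite -/(degree T c) dc.
rewrite !inE in aN bN dN.
(* An arm starts in [S] and alternates. The vertices other than [c] outside [S] have degree exactly
   2, so an arm longer than one vertex has at least three. *)
have arm x : adj T c x -> degree T x = 1%N \/ exists x2 x3,
    [/\ adj T x x2, adj T x2 x3, x2 != c & x3 != x] /\ (x2 \notin S /\ x3 \in S).
  move=> cx; have xS := offS _ _ cx cS.
  have [dx|dx] := leqP 2 (degree T x).
    right; have [x2 xx2 x2c] := exists_other_nbr c dx.
    have x2S := inS _ _ xx2 xS.
    have [|x3 x23 x3x] := @exists_other_nbr n T x2 x; first by rewrite degS.
    by exists x2, x3; split=> //; split=> //; apply: offS x23 x2S.
  left; apply/eqP; rewrite eqn_leq -ltnS dx.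
  by apply: (@degree_ge_size n T x [:: c]); rewrite //= adj_sym cx.
have spider x y z : adj T c x -> adj T c y -> adj T c z ->
    [/\ x != y, x != z & y != z] ->
    (exists x2 x3, [/\ adj T x x2, adj T x2 x3, x2 != c & x3 != x] /\
       (x2 \notin S /\ x3 \in S)) ->
    (exists x2 x3, [/\ adj T y x2, adj T x2 x3, x2 != c & x3 != y] /\
       (x2 \notin S /\ x3 \in S)) ->
    embeds spider133 T.
  move=> cx cy cz ne [x2 [x3 [[? ? ? ?] [? ?]]]] [y2 [y3 [[? ? ? ?] [? ?]]]].
  apply: (@spider133_embeds n T S c x y z x2 x3 y2 y3) => //.
  by split=> //; [move: cx|move: cy|move: cz] => /offS; apply.
have De x y z : adj T c x -> adj T c y -> adj T c z ->
    [/\ x != y, x != z & y != z] -> degree T x = 1%N -> degree T y = 1%N ->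
    embeds (D_graph n) T.
  move=> cx cy cz [xy xz yz] dx dy.
  apply: (@D_graph_embeds n T c x y z) => //.
  have ne v : adj T c v -> v != c.
    by move=> cv; apply: contraTneq cv => ->; rewrite adj_irr.
  by rewrite /= !inE !negb_or xy xz yz !ne // eq_sym ne.
have ad : a != d by rewrite eq_sym.
have ba : b != a by rewrite eq_sym.
have db : d != b by rewrite eq_sym.
case: (arm a aN) => [a1|a1]; case: (arm b bN) => [b1|b1].
- by constructor 4; split=> //; apply: (De a b d).
- case: (arm d dN) => [d1|d1].
    by constructor 4; split=> //; apply: (De a d b).
  by constructor 3; split=> //; apply: (spider b d a).
- case: (arm d dN) => [d1|d1].
    by constructor 4; split=> //; apply: (De b d a).
  by constructor 3; split=> //; apply: (spider a d b).
- by constructor 3; split=> //; apply: (spider a b d).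
Qed.

(** * The trees D_n and W_n *)

(* Neighbour lists, valid for [5 <= n] and [6 <= n] respectively. *)
Definition D_nbrs (n i : nat) : seq nat :=
  if (i == 0%N) || (i == n - 1)%N then [:: 1%N]
  else if i == 1%N then [:: 0; 2; n - 1]%N
  else if (i == n - 2)%N then [:: n - 3]%N
  else [:: i.-1; i.+1]%N.

Definition W_nbrs (n i : nat) : seq nat :=
  if (i == 0%N) || (i == n - 2)%N then [:: 1%N]
  else if (i == n - 3)%N || (i == n - 1)%N then [:: n - 4]%N
  else if i == 1%N then [:: 0; 2; n - 2]%N
  else if (i == n - 4)%N then [:: n - 5; n - 3; n - 1]%N
  else [:: i.-1; i.+1]%N.

Lemma D_adjE n (i j : 'I_n) : (5 <= n)%N ->
  adj (D_graph n) i j = (val j \in D_nbrs n i).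
Proof.
move=> n5; rewrite /= /rel_adj -val_eqE /=.
have := ltn_ord i; have := ltn_ord j.
move: (nat_of_ord i) (nat_of_ord j) => {}i {}j jn i_n; rewrite /D_nbrs.
apply/idP/idP.
  case/andP=> _ /orP[] /orP[] /andP[];
    by (do 3 (case: ifP => ?; rewrite ?inE; first by lia)); lia.
case: ifP => [h|h0]; first by rewrite inE => /eqP->; lia.
case: ifP => [h|h1]; first by rewrite !inE => /or3P[] /eqP->; lia.
case: ifP => [h|h2]; first by rewrite inE => /eqP->; lia.
by rewrite !inE => /orP[] /eqP->; lia.
Qed.

Lemma W_adjE n (i j : 'I_n) : (6 <= n)%N ->
  adj (W_graph n) i j = (val j \in W_nbrs n i).
Proof.
move=> n6; rewrite /= /rel_adj -val_eqE /=.
have := ltn_ord i; have := ltn_ord j.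
move: (nat_of_ord i) (nat_of_ord j) => {}i {}j jn i_n; rewrite /W_nbrs.
apply/idP/idP.
  case/andP=> _ /orP[] /or3P[] /andP[];
    by (do 4 (case: ifP => ?; rewrite ?inE; first by lia)); lia.
case: ifP => [h|h0]; first by rewrite inE => /eqP->; lia.
case: ifP => [h|h1]; first by rewrite inE => /eqP->; lia.
case: ifP => [h|h2]; first by rewrite !inE => /or3P[] /eqP->; lia.
case: ifP => [h|h3]; first by rewrite !inE => /or3P[] /eqP->; lia.
by rewrite !inE => /orP[] /eqP->; lia.
Qed.

Lemma D_nbrs_uniq n i : (5 <= n)%N -> (i < n)%N ->
  uniq (D_nbrs n i) && all (fun k => k < n)%N (D_nbrs n i).
Proof.
move=> n5 i_n; rewrite /D_nbrs; case: ifP => [h|h0]; first by rewrite /=; lia.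
case: ifP => [h|h1]; first by rewrite /= !inE; lia.
by case: ifP => [h|h2]; rewrite /= ?inE; lia.
Qed.

Lemma W_nbrs_uniq n i : (6 <= n)%N -> (i < n)%N ->
  uniq (W_nbrs n i) && all (fun k => k < n)%N (W_nbrs n i).
Proof.
move=> n6 i_n; rewrite /W_nbrs; case: ifP => [h|h0]; first by rewrite /=; lia.
case: ifP => [h|h1]; first by rewrite /=; lia.
case: ifP => [h|h2]; first by rewrite /= !inE; lia.
by case: ifP => [h|h3]; rewrite /= ?inE; lia.
Qed.

Lemma big_nbrs (V : nmodType) n (P : pred 'I_n) (l : seq nat) (F : nat -> V) :
  uniq l && all (fun k => k < n)%N l -> (forall j, P j = (val j \in l)) ->
  \sum_(j | P j) F j = \sum_(k <- l) F k.
Proof.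
case/andP=> ul /allP ln Pl; rewrite (eq_bigl _ _ Pl).
rewrite -(big_mkord (fun k => k \in l) F) -big_filter; apply: perm_big.
apply: uniq_perm => // [|k]; first by rewrite filter_uniq // iota_uniq.
rewrite mem_filter mem_index_iota /=; case kl: (k \in l) => //=.
exact: ln.
Qed.

Lemma degree_nbrs n (G : sgraph n) i (l : seq nat) :
  (forall j, adj G i j = (val j \in l)) -> (degree G i <= size l)%N.
Proof.
move=> il; rewrite /degree cardE -(size_map val); apply: uniq_leq_size.
  by rewrite map_inj_uniq ?enum_uniq //; apply: val_inj.
by move=> k /mapP[j]; rewrite mem_enum inE il => jl ->.
Qed.

(** * Connectedness and independence numbers of D_n and W_n *)

Lemma card_even_ord n : #|[set i : 'I_n | ~~ odd i]| = uphalf n.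
Proof.
rewrite -sum1dep_card big_mkcond /=.
elim: n => [|n IHn]; first by rewrite big_ord0.
rewrite big_ord_recr /= IHn uphalf_half /=.
by case: (odd n); rewrite ?addn0 ?addn1.
Qed.

(** The degree sum outside [S] gives n - 1 <= 2 (n - |S|) + |B|. *)
Lemma independent_card_le n (G : sgraph n) (B S : {set 'I_n}) :
  connected_graph G -> (forall v, degree G v <= 2 + (v \in B))%N ->
  independent G S -> (2 * #|S| <= n + 1 + #|B|)%N.
Proof.
move=> Gc dB indS; have nD := order_le_degree_sum Gc indS.
have DB : (\sum_(v in ~: S) degree G v <= #|~: S| * 2 + #|B|)%N.
  apply: (@leq_trans (\sum_(v in ~: S) (2 + (v \in B)))%N).
    by apply: leq_sum.
  rewrite big_split /= sum_nat_const leq_add2l.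
  rewrite -sum1_card big_mkcond [leqRHS]big_mkcond /=; apply: leq_sum => v _.
  by rewrite !inE; case: (v \in B); case: (v \in S).
have SC : (#|S| + #|~: S| = n)%N by rewrite cardsC card_ord.
have := leq_trans nD (DB : (_ < _.+1)%N).
move: (#|S|) (#|~: S|) (#|B|) SC => s t b <-; clear.
lia.
Qed.

Lemma independence_numberE n (G : sgraph n) k (S0 : {set 'I_n}) :
  independent G S0 -> #|S0| = k ->
  (forall S, independent G S -> (#|S| <= k)%N) -> independence_number G = k.
Proof.
move=> indS0 S0k maxS; apply/eqP; rewrite eqn_leq; apply/andP; split.
  by apply/bigmax_leqP => S /maxS.
by rewrite -S0k; apply: (@leq_bigmax_cond _ _ (fun S : {set 'I_n} => #|S|)) indS0.
Qed.

Lemma connected_to_root n (G : sgraph n) (r : 'I_n) :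
  (forall i, connect (adj G) r i) -> connected_graph G.
Proof.
move=> rG x y; apply: connect_trans (rG y).
by rewrite (sym_connect_sym (@adj_sym _ G)).
Qed.

Lemma D_graph_connected n : (5 <= n)%N -> connected_graph (D_graph n).
Proof.
move=> n5; have n0 : (0 < n)%N by lia.
have path_i k (kn : (k < n)%N) : (k < n - 1)%N ->
    connect (adj (D_graph n)) (Ordinal n0) (Ordinal kn).
  elim: k kn => [|k IHk] kn k1.
    by rewrite (_ : Ordinal kn = Ordinal n0) //; apply: val_inj.
  have kn' : (k < n)%N by lia.
  apply: connect_trans (IHk kn' _) _; first by lia.
  by apply: connect1; rewrite /= /rel_adj -val_eqE /=; lia.
apply: connected_to_root (Ordinal n0) _ => -[i i_n].
have [i1|i1] := ltnP i (n - 1)%N; first exact: path_i.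
have n1 : (1 < n)%N by lia.
apply: connect_trans (path_i 1%N n1 _) _; first by lia.
by apply: connect1; rewrite /= /rel_adj -val_eqE /=; lia.
Qed.

Lemma W_graph_connected n : (6 <= n)%N -> connected_graph (W_graph n).
Proof.
move=> n6; have n0 : (0 < n)%N by lia.
have path_i k (kn : (k < n)%N) : (k < n - 2)%N ->
    connect (adj (W_graph n)) (Ordinal n0) (Ordinal kn).
  elim: k kn => [|k IHk] kn k1.
    by rewrite (_ : Ordinal kn = Ordinal n0) //; apply: val_inj.
  have kn' : (k < n)%N by lia.
  apply: connect_trans (IHk kn' _) _; first by lia.
  by apply: connect1; rewrite /= /rel_adj -val_eqE /=; lia.
apply: connected_to_root (Ordinal n0) _ => -[i i_n].
have [i1|i1] := ltnP i (n - 2)%N; first exact: path_i.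
have n1 : (1 < n)%N by lia.
have n4 : (n - 4 < n)%N by lia.
have [in2|in2] := eqVneq i (n - 2)%N.
  apply: connect_trans (path_i 1%N n1 _) _; first by lia.
  by apply: connect1; rewrite /= /rel_adj -val_eqE /=; lia.
apply: connect_trans (path_i _ n4 _) _; first by lia.
by apply: connect1; rewrite /= /rel_adj -val_eqE /=; lia.
Qed.

Lemma card_even_add n (r : 'I_n) : odd r ->
  #|[set i : 'I_n | ~~ odd i || (i == r)]| = (uphalf n).+1.
Proof.
move=> oddr; have -> : [set i : 'I_n | ~~ odd i || (i == r)] =
    r |: [set i : 'I_n | ~~ odd i].
  by apply/setP => i; rewrite !inE orbC.
by rewrite cardsU1 inE oddr card_even_ord.
Qed.

Lemma D_graph_in_family n : (6 <= n)%N -> ~~ odd n ->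
  in_family (uphalf n).+1 (D_graph n).
Proof.
move=> n6 evn; have n5 : (5 <= n)%N by lia.
have Dc := D_graph_connected n5.
split=> //; have rn : (n - 1 < n)%N by lia.
(* The pendant vertex n - 1 is odd and its only neighbour is the odd vertex 1, so it can join the
   even vertices. *)
apply: (@independence_numberE _ _ _
    [set i : 'I_n | ~~ odd i || (i == Ordinal rn)]).
- apply/forall_inP => i; rewrite inE -val_eqE /= => iS.
  apply/forall_inP => j; rewrite inE -val_eqE /= => jS.
  by rewrite /rel_adj -val_eqE /=; have := ltn_ord i; have := ltn_ord j; lia.
- by apply: card_even_add => /=; lia.
move=> S indS; have n1 : (1 < n)%N by lia.
have degD v : (degree (D_graph n) v <= 2 + (v \in [set Ordinal n1]))%N.
  apply: leq_trans (degree_nbrs (fun j => D_adjE v j n5)) _.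
  rewrite inE -val_eqE /= /D_nbrs.
  case: ifP => // _; case: ifP => // _; by case: ifP.
have := independent_card_le Dc degD indS; rewrite cards1.
by rewrite uphalf_half; have := odd_double_half n; rewrite -addnn; lia.
Qed.

Lemma W_graph_in_family n : (6 <= n)%N -> odd n ->
  in_family (uphalf n).+1 (W_graph n).
Proof.
move=> n6 oddn; have Wc := W_graph_connected n6.
split=> //; have rn : (n - 2 < n)%N by lia.
(* The pendant vertex n - 2 is odd and its only neighbour is the odd vertex 1; the other pendant
   vertex n - 1 is already even. *)
apply: (@independence_numberE _ _ _
    [set i : 'I_n | ~~ odd i || (i == Ordinal rn)]).
- apply/forall_inP => i; rewrite inE -val_eqE /= => iS.
  apply/forall_inP => j; rewrite inE -val_eqE /= => jS.
  by rewrite /rel_adj -val_eqE /=; have := ltn_ord i; have := ltn_ord j; lia.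
- by apply: card_even_add => /=; lia.
move=> S indS; have n1 : (1 < n)%N by lia.
have n4 : (n - 4 < n)%N by lia.
have degW v :
    (degree (W_graph n) v <= 2 + (v \in [set Ordinal n1; Ordinal n4]))%N.
  apply: leq_trans (degree_nbrs (fun j => W_adjE v j n6)) _.
  rewrite !inE -!val_eqE /= /W_nbrs.
  case: ifP => // _; case: ifP => // _; case: ifP => // _.
  by case: ifP.
have c2 : (#|[set Ordinal n1; Ordinal n4]| <= 2)%N by rewrite cards2; case: eqP.
have := leq_trans (independent_card_le Wc degW indS) (leq_add (leqnn (n + 1)%N) c2).
have := odd_double_half n; rewrite uphalf_half -addnn oddn.
by move: (#|S|) => k; clear; lia.
Qed.

(** * Test vectors *)

Section TestVectors.
Variables (R : realType) (sigma kappa theta e : R).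

Local Notation s := (1 - sigma).

Lemma Aop_nbrs n (G : sgraph n) (F : nat -> R) (i : 'I_n) (l : seq nat) :
  uniq l && all (fun k => k < n)%N l -> (forall j, adj G i j = (val j \in l)) ->
  Aop sigma G (fun j => F j) i = \sum_(k <- l) (sigma * F i + s * F k).
Proof. by move=> ul il; apply: (big_nbrs (fun k => sigma * F i + s * F k) ul). Qed.

(** A solution decaying away from the branch vertex 1, where it equals 1. *)
Definition D_vec n (k : nat) : R :=
  if (k == 0%N) || (k == n - 1)%N then e else theta ^+ k.-1.

Lemma D_vec_pendant n k : (k == 0%N) || (k == n - 1)%N -> D_vec n k = e.
Proof. by rewrite /D_vec => ->. Qed.

Lemma D_vec_path n k : (0 < k < n - 1)%N -> D_vec n k = theta ^+ k.-1.
Proof. by rewrite /D_vec; case: ifP => //; lia. Qed.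

(** The sum of two solutions decaying from the branch vertices 1 and n - 4. Both branch vertices get
    the value [1 + theta ^+ (n - 5)], and the four leaves [e] times that. *)
Definition W_vec n (k : nat) : R :=
  if [|| k == 0, k == n - 3, k == n - 2 | k == n - 1]%N
  then e * (1 + theta ^+ (n - 5)) else theta ^+ k.-1 + theta ^+ (n - 4 - k).

(** The error A x - kappa x of [W_vec] at either branch vertex. *)
Definition W_defect n : R :=
  (3 * sigma - kappa + 2 * s * e) * (1 + theta ^+ (n - 5))
  + s * (theta + theta ^+ (n - 6)).

Lemma W_vec_pendant n k : [|| k == 0, k == n - 3, k == n - 2 | k == n - 1]%N ->
  W_vec n k = e * (1 + theta ^+ (n - 5)).
Proof. by rewrite /W_vec => ->. Qed.

Lemma W_vec_path n k : (0 < k < n - 3)%N ->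
  W_vec n k = theta ^+ k.-1 + theta ^+ (n - 4 - k).
Proof. by rewrite /W_vec; case: ifP => //; lia. Qed.

(* [theta ^+ k] solves the eigenvalue equation [kappa] along a path, and [e] is
   the ratio it imposes between a pendant vertex and its neighbour. *)
Hypothesis thetaE : (1 - sigma) * (theta ^+ 2 + 1) = (kappa - 2 * sigma) * theta.
Hypothesis eE : sigma * e + (1 - sigma) = kappa * e.

Lemma W_vec_Aop n (i : 'I_n) : (6 <= n)%N ->
  Aop sigma (W_graph n) (fun j => W_vec n j) i =
  kappa * W_vec n i +
  (if (val i == 1%N) || (val i == n - 4)%N then W_defect n else 0).
Proof.
move=> n6.
have eE' x : sigma * (e * x) + s * x = kappa * (e * x).
  by rewrite [kappa * _]mulrA -eE; ring.
rewrite (Aop_nbrs (W_vec n) (W_nbrs_uniq n6 (ltn_ord i)) (fun j => W_adjE i j n6)).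
have := ltn_ord i; rewrite /= /W_nbrs; move: (nat_of_ord i) => {}i i_n.
have [m mE] : exists m, n = (m + 6)%N by exists (n - 6)%N; lia.
case: ifP => [h|h0].
  have -> : (i == 1%N) || (i == n - 4)%N = false by lia.
  rewrite big_seq1 addr0 W_vec_pendant; last lia.
  rewrite W_vec_path /=; last lia.
  by rewrite expr0 -subnDA eE'.
case: ifP => [h|h1].
  have -> : (i == 1%N) || (i == n - 4)%N = false by lia.
  rewrite big_seq1 addr0 W_vec_pendant; last lia.
  rewrite W_vec_path /=; last lia.
  rewrite subnn expr0 -subn1 -subnDA [_ + 1]addrC.
  exact: eE'.
case: eqP => [->|i1] /=.
  rewrite !big_cons big_nil addr0 (@W_vec_pendant _ 0%N) //.
  rewrite (@W_vec_pendant _ (n - 2)%N); last lia.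
  rewrite !W_vec_path; [|lia|lia].
  rewrite /W_defect mE /= expr0 expr1.
  have -> : (m + 6 - 5)%N = m.+1 by lia.
  have -> : (m + 6 - 6)%N = m by lia.
  have -> : (m + 6 - 4 - 1)%N = m.+1 by lia.
  have -> : (m + 6 - 4 - 2)%N = m by lia.
  ring.
case: eqP => [->|i4].
  rewrite !big_cons big_nil addr0 (@W_vec_pendant _ (n - 3)%N); last lia.
  rewrite (@W_vec_pendant _ (n - 1)%N); last lia.
  rewrite !W_vec_path; [|lia|lia].
  rewrite /W_defect mE.
  have -> : (m + 6 - 5)%N = m.+1 by lia.
  have -> : (m + 6 - 6)%N = m by lia.
  have -> : (m + 6 - 4)%N = m.+2 by lia.
  rewrite subnn subSnn /= expr0 expr1.
  ring.
have [k kE] : exists k, i = k.+2 by exists (i - 2)%N; lia.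
have [l lE] : exists l, n = (l + k + 7)%N by exists (n - 7 - k)%N; lia.
rewrite kE !big_cons big_nil !addr0 !W_vec_path /=; [|lia|lia|lia].
have -> : (n - 4 - k.+1)%N = l.+2 by lia.
have -> : (n - 4 - k.+3)%N = l by lia.
have -> : (n - 4 - k.+2)%N = l.+1 by lia.
have E j : s * theta ^+ j + s * theta ^+ j.+2 = (kappa - 2 * sigma) * theta ^+ j.+1.
  rewrite !exprS [RHS]mulrA -thetaE; ring.
have -> : kappa * (theta ^+ k.+1 + theta ^+ l.+1) =
  2 * sigma * (theta ^+ k.+1 + theta ^+ l.+1) +
  ((kappa - 2 * sigma) * theta ^+ k.+1 + (kappa - 2 * sigma) * theta ^+ l.+1) by ring.
rewrite -!E; ring.
Qed.

Hypotheses (sigma_ge0 : 0 <= sigma) (sigma_lt1 : sigma < 1).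
Hypotheses (kappa_ge2 : 2 <= kappa) (theta_gt0 : 0 < theta) (theta_le1 : theta <= 1).

Let s_gt0 : 0 < s. Proof. by rewrite subr_gt0. Qed.

Let e_gt0 : 0 < e.
Proof.
have : (kappa - sigma) * e = s by rewrite mulrBl -eE; ring.
have : 0 < kappa - sigma by move: sigma_lt1 kappa_ge2; lra.
by move=> k0 ek; rewrite -(pmulr_rgt0 _ k0) ek.
Qed.

Lemma W_vec_gt0 n k : 0 < W_vec n k.
Proof.
rewrite /W_vec; case: ifP => _; rewrite ?mulr_gt0 //.
  by rewrite ltr_wpDr ?exprn_ge0 // ltW.
by rewrite ltr_wpDr ?exprn_ge0 ?exprn_gt0 // ltW.
Qed.

(** The hypothesis is the inequality A z <= kappa z for [D_vec] at the branch vertex. At the end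
    leaf n - 2 the next path vertex is missing, which makes the inequality strict there. *)
Lemma D_radius_lt n : (5 <= n)%N -> 3 * sigma + 2 * s * e + s * theta <= kappa ->
  spectral_radius sigma (D_graph n) < kappa.
Proof.
move=> n5 ub; have nn2 : (n - 2 < n)%N by lia.
have AopE i := Aop_nbrs (D_vec n) (D_nbrs_uniq n5 (ltn_ord i))
  (fun j => D_adjE i j n5).
have end_lt k : s * theta ^+ k + sigma * theta ^+ k.+1 < kappa * theta ^+ k.+1.
  have tk : 0 < theta ^+ k by rewrite exprn_gt0.
  have E : kappa * theta = s * (theta ^+ 2 + 1) + 2 * sigma * theta.
    by rewrite thetaE; ring.
  rewrite exprS [kappa * _]mulrA E -subr_gt0.
  rewrite (_ : _ - _ = theta ^+ k * theta * (s * theta + sigma)); last by ring.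
  by rewrite !mulr_gt0 // ltr_wpDr // mulr_gt0.
apply: (@spectral_radius_lt R sigma sigma_ge0 sigma_lt1 n (D_graph n)
  (fun j => D_vec n j) kappa (Ordinal nn2)).
- exact: D_graph_connected.
- by move=> j; rewrite /D_vec; case: ifP; rewrite ?exprn_gt0.
- move=> i; rewrite AopE /D_nbrs.
  case: ifP => [h|h0].
    by rewrite big_seq1 D_vec_pendant // D_vec_path /= ?mulr1 ?eE //; lia.
  case: eqP => [i1|i1].
    rewrite i1 !big_cons big_nil addr0 (@D_vec_pendant _ 0%N) //.
    rewrite (@D_vec_pendant _ (n - 1)%N) ?eqxx ?orbT //.
    rewrite !D_vec_path /= ?expr1 ?expr0; [|lia|lia].
    by move: ub; lra.
  case: eqP => [in2|in2].
    rewrite big_seq1 in2.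
    have [k kE] : exists k, n = (k + 4)%N by exists (n - 4)%N; lia.
    rewrite !D_vec_path; [|lia|lia]; rewrite kE.
    have -> : (k + 4 - 2).-1 = k.+1 by lia.
    have -> : (k + 4 - 3).-1 = k by lia.
    by rewrite addrC ltW.
  have [k kE] : exists k, nat_of_ord i = k.+2.
    by exists (i - 2)%N; have := ltn_ord i; lia.
  have := ltn_ord i; rewrite kE in h0 i1 in2 * => k_n.
  rewrite !big_cons big_nil addr0 !D_vec_path /=; [|lia|lia|lia].
  rewrite !exprS (_ : _ + _ =
    theta ^+ k * (s * (theta ^+ 2 + 1) + 2 * sigma * theta)).
    by rewrite thetaE le_eqVlt; apply/orP; left; apply/eqP; ring.
  ring.
- rewrite AopE /D_nbrs /=.
  have -> : (n - 2 == 0)%N || (n - 2 == n - 1)%N = false by lia.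
  have -> : (n - 2 == 1)%N = false by lia.
  rewrite eqxx big_seq1.
  have [k kE] : exists k, n = (k + 4)%N by exists (n - 4)%N; lia.
  rewrite !D_vec_path; [|lia|lia]; rewrite kE.
  have -> : (k + 4 - 2).-1 = k.+1 by lia.
  have -> : (k + 4 - 3).-1 = k by lia.
  by rewrite addrC.
Qed.

Lemma W_radius_lt n : (6 <= n)%N -> W_defect n < 0 ->
  spectral_radius sigma (W_graph n) < kappa.
Proof.
move=> n6 neg; have n1 : (1 < n)%N by lia.
apply: (@spectral_radius_lt R sigma sigma_ge0 sigma_lt1 n (W_graph n)
  (fun j => W_vec n j) kappa (Ordinal n1)).
- exact: W_graph_connected.
- by move=> j; apply: W_vec_gt0.
- move=> i; rewrite W_vec_Aop //; case: ifP => _; rewrite ?addr0 //.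
  by rewrite gerDl ltW.
- by rewrite W_vec_Aop //= gtrDl.
Qed.

Local Notation branch := (3 * sigma - kappa + 2 * s * e).

Let powE m : (6 <= m)%N -> theta ^+ (m - 5) = theta * theta ^+ (m - 6).
Proof. by move=> m6; rewrite -exprS -subSn. Qed.

Let pow_bounds k : 0 < theta ^+ k <= 1.
Proof. by rewrite exprn_gt0 // exprn_ile1 // ltW. Qed.

(** Divided by [1 + theta ^+ (m - 5)], the defect is [branch] plus [s] times (theta + x) / (1 +
    theta x) with x = [theta ^+ (m - 6)]. This is nondecreasing in x, hence nonincreasing in m. *)
Lemma W_defect_mono m n : (6 <= m <= n)%N -> 0 <= W_defect n -> 0 <= W_defect m.
Proof.
move=> /andP[m6 mn]; have n6 := leq_trans m6 mn.
rewrite /W_defect -/branch !powE //.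
have : theta ^+ (n - 6) <= theta ^+ (m - 6).
  by apply: ler_wiXn2l => //; [exact: ltW | exact: leq_sub2r].
have /andP[] := pow_bounds (n - 6); have /andP[] := pow_bounds (m - 6).
move: (theta ^+ (n - 6)) (theta ^+ (m - 6)) branch => y x c x0 x1 y0 y1 yx h.
have p : 0 < 1 + theta * y by rewrite ltr_pwDl // mulr_ge0 // ltW.
rewrite -(pmulr_rge0 _ p).
have -> : (1 + theta * y) * (c * (1 + theta * x) + s * (theta + x)) =
  (1 + theta * x) * (c * (1 + theta * y) + s * (theta + y)) +
  s * ((1 - theta ^+ 2) * (x - y)) by ring.
rewrite addr_ge0 //; first by rewrite mulr_ge0 // addr_ge0 // mulr_ge0 // ltW.
by rewrite !mulr_ge0 ?subr_ge0 ?expr_le1 // ltW.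
Qed.

(** The quotient (theta + y) / (1 + theta y) is at most 1, because (1 - theta) (1 - y) >= 0. *)
Lemma W_defect_star n : (6 <= n)%N -> 0 <= W_defect n -> 0 <= branch + s.
Proof.
move=> n6; rewrite /W_defect powE //.
have /andP[] := pow_bounds (n - 6).
move: (theta ^+ (n - 6)) branch => y c y0 y1 h.
have p : 0 < 1 + theta * y by rewrite ltr_pwDl // mulr_ge0 // ltW.
rewrite -(pmulr_rge0 _ p).
have -> : (1 + theta * y) * (c + s) =
  c * (1 + theta * y) + s * (theta + y) + s * ((1 - theta) * (1 - y)) by ring.
by rewrite addr_ge0 // !mulr_ge0 ?subr_ge0 // ltW.
Qed.

(** Compares W_m with D_n: [branch + s * theta] is the error of [D_vec] at its branch vertex, and
    the second summand is nonnegative. *)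
Lemma W_defectE m : (6 <= m)%N -> W_defect m =
  (branch + s * theta) * (1 + theta ^+ (m - 5))
  + s * ((1 - theta ^+ 2) * theta ^+ (m - 6)).
Proof. move=> m6; rewrite /W_defect powE //; ring. Qed.

Let defect_rest m : 0 <= s * ((1 - theta ^+ 2) * theta ^+ (m - 6)).
Proof.
by rewrite !mulr_ge0 ?subr_ge0 ?expr_le1 ?exprn_ge0 // ltW.
Qed.

Lemma W_defect_ge0 m : (6 <= m)%N -> 0 <= branch + s * theta -> 0 <= W_defect m.
Proof.
move=> m6 h; rewrite W_defectE // addr_ge0 // mulr_ge0 //.
by rewrite addr_ge0 // exprn_ge0 // ltW.
Qed.

Lemma W_defect_gt0 m : (6 <= m)%N -> 0 < branch + s * theta -> 0 < W_defect m.
Proof.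
move=> m6 h; rewrite W_defectE // ltr_wpDr // mulr_gt0 //.
by rewrite ltr_wpDr // exprn_ge0 // ltW.
Qed.

(** * Rigidity of embeddings into a graph of radius at most kappa *)

Variables (n : nat) (H : sgraph n).
Hypotheses (Hc : connected_graph H) (H_le : spectral_radius sigma H <= kappa).

Lemma embed_rigid_test m (K : sgraph m) (F : nat -> R) : (0 < m)%N ->
    (forall k, 0 < F k) ->
    (forall i : 'I_m, kappa * F i <= Aop sigma K (fun j => F j) i) ->
    embeds K H ->
  [/\ spectral_radius sigma H = kappa, m = n,
      exists2 f : 'I_m -> 'I_n, bijective f &
        forall i j, adj H (f i) (f j) = adj K i j
    & forall i : 'I_m, Aop sigma K (fun j => F j) i = kappa * F i].
Proof.
move=> m0 F0 FK [f [injf homf]].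
have [||||Hk bf isof eqF] := @embed_rigid R sigma sigma_ge0 sigma_lt1 m n K H f
  (fun i => F i) kappa (Ordinal m0) Hc injf homf.
- by move=> i; rewrite ltW.
- by rewrite gt_eqF.
- rewrite /dotp mulr_sumr; apply: ler_sum => i _.
  by rewrite mulrCA ler_wpM2l // ltW.
- exact: H_le.
split=> //; last by exists f.
by rewrite -[m]card_ord -[n]card_ord; apply: bij_eq_card bf.
Qed.

Lemma W_embeds_rigid m : (6 <= m)%N -> 0 <= W_defect m -> embeds (W_graph m) H ->
  [/\ spectral_radius sigma H = kappa, m = n, 
      exists2 f : 'I_m -> 'I_n, bijective f &
        forall i j, adj H (f i) (f j) = adj (W_graph m) i j
    & W_defect m = 0].
Proof.
move=> m6 dm emb; have m0 : (0 < m)%N by apply: leq_trans m6.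
have m1 : (1 < m)%N by apply: leq_trans m6.
have AE i := W_vec_Aop i m6.
have [||Hk mn iso eqF] := embed_rigid_test (F := W_vec m) m0 _ _ emb.
- by move=> k; apply: W_vec_gt0.
- by move=> i; rewrite AE; case: ifP => _; rewrite ?addr0 // lerDl.
split=> //; have := eqF (Ordinal m1); rewrite AE /=.
by rewrite -[X in _ = X]addr0 => /addrI.
Qed.

Lemma star5_not_embeds : (9 <= n)%N -> 0 <= branch + s -> ~ embeds star5 H.
Proof.
move=> n9 h emb; pose F k : R := if k == 0%N then 1 else e.
have [||_ mn _ _] := embed_rigid_test (F := F) (ltn0Sn 4) _ _ emb.
- by move=> k; rewrite /F; case: ifP.
- move=> i; pose l := if val i == 0%N then [:: 1; 2; 3; 4]%N else [:: 0%N].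
  rewrite (@Aop_nbrs 5 star5 F i l).
  + rewrite /l /F; case: ifP => _; last first.
      by rewrite big_seq1 mulr1 eE.
    rewrite !big_cons big_nil /= addr0.
    (* The error at the centre, [4 * sigma + 4 * s * e - kappa], is twice [branch + s] plus
       [kappa - 2]. *)
    by move: h kappa_ge2; lra.
  + by rewrite /l; case: ifP.
  + move=> j; rewrite /l; clear l; rewrite /= /rel_adj.
    by case: i j => [[|[|[|[|[|i]]]]] //= ?]
      [[|[|[|[|[|j]]]]] //= ?].
by move: n9; rewrite -mn.
Qed.

(** The exact solution along each arm, with value 1 at the branch vertex, leaves an error only
    there, and it is at least the error [branch + s * theta] of [D_vec]. *)
Lemma spider133_not_embeds : (9 <= n)%N -> 0 <= branch + s * theta ->
  ~ embeds spider133 H.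
Proof.
move=> n9 h emb; have th0 := theta_gt0; have th1 := theta_le1; have e0 := e_gt0.
have [q [qE q2 qth]] : exists q, [/\ s * q = kappa - 2 * sigma, 2 <= q &
    theta ^+ 2 + 1 = q * theta].
  exists ((kappa - 2 * sigma) / s).
  have qE : s * ((kappa - 2 * sigma) / s) = kappa - 2 * sigma.
    by field; rewrite gt_eqF.
  split=> //.
    by rewrite ler_pdivlMr //; move: kappa_ge2 sigma_ge0; lra.
  by apply: (mulfI (lt0r_neq0 s_gt0)); rewrite thetaE mulrA qE.
have qe : q * e <= 1.
  have : s * (1 - q * e) = sigma * e.
    rewrite mulrBr mulr1 mulrA qE; move: eE => E.
    have -> : s = kappa * e - sigma * e by rewrite -E; ring.
    ring.
  rewrite -subr_ge0 -(pmulr_rge0 _ s_gt0) => ->.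
  by rewrite mulr_ge0 // ltW.
have e2 : e <= 1 / 2 by move: e_gt0; nra.
have eth : e <= theta by move: e_gt0 theta_gt0 theta_le1; nra.
(* A continued fraction: the path equation [x + z = q * y] forces the values [r], [r * f],
   [r * f * e] outwards along an arm of three vertices. *)
pose f := (q - e)^-1; pose r := (q - f)^-1.
have qe0 : 0 < q - e by lra.
have fE : f * (q - e) = 1 by rewrite mulVf // gt_eqF.
have f0 : 0 < f by rewrite invr_gt0.
(* The bounds 2/3 on [f] and 3/4 on [r] are the values at the extreme case [q = 2], [e = 1 / 2];
   their product is the 1/2 used below. *)
have f23 : f <= 2 / 3 by nra.
have qf0 : 0 < q - f by lra.
have rE : r * (q - f) = 1 by rewrite mulVf // gt_eqF.
have r0 : 0 < r by rewrite invr_gt0.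
have r34 : r <= 3 / 4 by nra.
have diff : theta - r = theta ^+ 2 * (f * r) * (theta - e).
  have E1 : theta - f = theta * f * (theta - e).
    have -> : theta * f * (theta - e) =
      theta * (f * (q - e)) - f * (q * theta - theta ^+ 2) by ring.
    by rewrite fE -qth; ring.
  have -> : theta ^+ 2 * (f * r) * (theta - e) =
    theta * r * (theta * f * (theta - e)) by ring.
  rewrite -E1.
  have -> : theta * r * (theta - f) =
    theta * (r * (q - f)) - r * (q * theta - theta ^+ 2) by ring.
  by rewrite rE -qth; ring.
(* The error at the branch vertex exceeds [branch + s * theta] by [s * (2 * r - e - theta)]. By
   [diff], [theta - r] is at most half of [theta - e]. *)
have r_ge : e + theta <= 2 * r.
  have fr : f * r <= 1 / 2 by nra.
  have fr0 : 0 < f * r by rewrite mulr_gt0.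
  have th2 : 0 <= theta ^+ 2 <= 1 by rewrite exprn_ge0 ?exprn_ile1 // ltW.
  have : theta ^+ 2 * (f * r) <= 1 / 2.
    by move: (theta ^+ 2) (f * r) th2 fr fr0 => t u /andP[]; nra.
  by move: diff; move: (theta ^+ 2 * (f * r)) => u; nra.
pose F := nth 1 [:: r * f * e; r * f; r; 1; r; r * f; r * f * e; e].
have F0 k : 0 < F k.
  rewrite /F; case: k => [|[|[|[|[|[|[|[|k]]]]]]]] //=;
    by rewrite ?nth_nil ?mulr_gt0.
have leaf : sigma * (r * f * e) + s * (r * f) = kappa * (r * f * e).
  have -> : kappa * (r * f * e) = r * f * (kappa * e) by ring.
  by rewrite -eE; ring.
have path x y z : x + z = q * y ->
    sigma * y + s * x + (sigma * y + s * z) = kappa * y.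
  move=> xz; have -> : sigma * y + s * x + (sigma * y + s * z) =
    2 * sigma * y + s * (x + z) by ring.
  by rewrite xz mulrA qE; ring.
have E1 : r * f * e + r = q * (r * f).
  have -> : q * (r * f) = r * f * e + r * (f * (q - e)) by ring.
  by rewrite fE mulr1.
have E2 : r * f + 1 = q * r by rewrite -rE; ring.
have E3 := etrans (addrC _ _) E1; have E4 := etrans (addrC _ _) E2.
have [i|_ mn _ _] := embed_rigid_test (F := F) (ltn0Sn 7) F0 _ emb; last first.
  by move: n9; rewrite -mn.
pose l := nth [::] [:: [:: 1]; [:: 0; 2]; [:: 1; 3]; [:: 2; 4; 7]; [:: 3; 5];
  [:: 4; 6]; [:: 5]; [:: 3]]%N (val i).
rewrite (@Aop_nbrs 8 spider133 F i l).
- rewrite /l; clear l; case: i => [[|[|[|[|[|[|[|[|i]]]]]]]] //= ?];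
    rewrite ?big_cons ?big_nil ?addr0 /F /= ?leaf //.
  + by rewrite path.
  + by rewrite path.
  + have := mulr_ge0 (ltW s_gt0) (_ : 0 <= 2 * r - e - theta).
    rewrite -addrA -opprD subr_ge0 => /(_ r_ge).
    by move: h; lra.
  + by rewrite path.
  + by rewrite path.
  + by rewrite mulr1 eE.
- by rewrite /l; clear l; case: i => [[|[|[|[|[|[|[|[|i]]]]]]]] //= ?].
- move=> j; rewrite /l; clear l; rewrite /= /rel_adj.
  by case: i j => [[|[|[|[|[|[|[|[|i]]]]]]]] //= ?]
      [[|[|[|[|[|[|[|[|j]]]]]]]] //= ?].
Qed.

End TestVectors.

(** [theta] is the smaller root of t^2 - q t + 1, written as 2 / (q + d) because the roots have
    product 1. It is real since kappa >= 2 amounts to q >= 2. *)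
Lemma decay_parameters (R : realType) (sigma kappa : R) :
  0 <= sigma -> sigma < 1 -> 2 <= kappa -> exists theta e : R,
  [/\ 0 < theta, theta <= 1,
      (1 - sigma) * (theta ^+ 2 + 1) = (kappa - 2 * sigma) * theta
    & sigma * e + (1 - sigma) = kappa * e].
Proof.
move=> s0 s1 k2; have sp : 0 < 1 - sigma by lra.
have kp : 0 < kappa - sigma by lra.
pose q := (kappa - 2 * sigma) / (1 - sigma).
have qE : (1 - sigma) * q = kappa - 2 * sigma by rewrite /q; field; rewrite gt_eqF.
have q2 : 2 <= q by rewrite /q ler_pdivlMr //; lra.
pose d := Num.sqrt (q ^+ 2 - 4).
have dE : d ^+ 2 = q ^+ 2 - 4 by rewrite sqr_sqrtr //; nra.
have d0 : 0 <= d by apply: sqrtr_ge0.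
have qd : 0 < q + d by lra.
exists (2 / (q + d)), ((1 - sigma) / (kappa - sigma)); split.
- by rewrite divr_gt0.
- by rewrite ler_pdivrMr //; lra.
- rewrite -qE -mulrA; congr (_ * _).
  have -> : (2 / (q + d)) ^+ 2 + 1 = (4 + (q + d) ^+ 2) / (q + d) ^+ 2.
    by field; rewrite gt_eqF.
  have -> : 4 + (q + d) ^+ 2 = 2 * q * (q + d).
    by rewrite sqrrD dE; ring.
  by field; rewrite gt_eqF.
- by field; rewrite gt_eqF.
Qed.

(** At kappa = 2 the quadratic for [theta] has the double root 1, and the second expression times
    [2 - sigma] equals [sigma]. *)
Lemma branch_ge0_at2 (R : realType) (sigma theta e : R) :
  0 <= sigma -> sigma < 1 ->
  (1 - sigma) * (theta ^+ 2 + 1) = (2 - 2 * sigma) * theta ->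
  sigma * e + (1 - sigma) = 2 * e ->
  theta = 1 /\ 0 <= 3 * sigma - 2 + 2 * (1 - sigma) * e + (1 - sigma).
Proof.
move=> s0 s1 thE eE; have sp : 0 < 1 - sigma by lra.
split.
  have : (1 - sigma) * (theta - 1) ^+ 2 = 0.
    rewrite sqrrB1 mulrDr mulrBr; move: thE; rewrite mulrDr; lra.
  by move/eqP; rewrite mulf_eq0 gt_eqF //= sqrf_eq0 subr_eq0 => /eqP.
have p : 0 < 2 - sigma by lra.
rewrite -(pmulr_rge0 _ p).
have -> : (2 - sigma) * (3 * sigma - 2 + 2 * (1 - sigma) * e + (1 - sigma)) =
  (2 - sigma) * (2 * sigma - 1) + 2 * (1 - sigma) * (2 * e - sigma * e) by ring.
rewrite -eE; have -> : sigma * e + (1 - sigma) - sigma * e = 1 - sigma by ring.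
nra.
Qed.

(** * Structure of the family and the final comparison *)

Lemma embeds_subrel m n (K : sgraph m) (T G : sgraph n) :
  subrel (adj T) (adj G) -> embeds K T -> embeds K G.
Proof. by move=> TG [f [injf homf]]; exists f; split=> // i j /homf /TG. Qed.

Lemma isomorphic_of_bijection n (H K : sgraph n) (f : 'I_n -> 'I_n) :
  bijective f -> (forall i j, adj H (f i) (f j) = adj K i j) -> isomorphic H K.
Proof.
case=> g fK gK fE; exists g; first by exists f.
by move=> x y; rewrite -fE !gK.
Qed.

(** A maximum independent set of [H] stays independent in a spanning tree, and [tree_structure] does
    not ask for maximality there. *)
Lemma family_structure n (H : sgraph n) : (4 <= n)%N ->
    in_family (uphalf n).+1 H ->
  [\/ embeds star5 H, exists2 m, (6 <= m)%N & embeds (W_graph m) H,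
      ~~ odd n /\ embeds spider133 H | ~~ odd n /\ embeds (D_graph n) H].
Proof.
move=> n4 [Hc Ha]; have [T [TH Tc acT]] := spanning_tree Hc.
have [S indS Sa] : exists2 S, independent H S & #|S| = (uphalf n).+1.
  have ind0 : (0 < #|[pred S | independent H S]|)%N.
    apply/card_gt0P; exists set0; rewrite inE.
    by apply/forall_inP => x; rewrite inE.
  have [S indS SE] := eq_bigmax_cond (fun S : {set 'I_n} => #|S|) ind0.
  by exists S; [move: indS | rewrite -Ha /independence_number -SE].
have indT : independent T S.
  apply/forall_inP => x xS; apply/forall_inP => y yS; apply/negP => /TH xy.
  by move/forall_inP: indS => /(_ x xS) /forall_inP /(_ y yS); rewrite xy.
have up m (K : sgraph m) := @embeds_subrel m n K T H TH.
case: (tree_structure n4 Tc acT indT Sa) => [e|[m m6 e]|[o e]|[o e]].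
- by constructor 1; apply: up.
- by constructor 2; exists m => //; apply: up.
- by constructor 3; split=> //; apply: up.
- by constructor 4; split=> //; apply: up.
Qed.

Theorem theorem1p2 (R : realType) (n : nat) (sigma : R) (H : sgraph n)
    (hn : (9 <= n)%N) (hsigma0 : 0 <= sigma) (hsigma1 : sigma < 1)
    (hH : minimizer sigma (uphalf n).+1 H) :
  (~~ odd n -> isomorphic H (D_graph n)) /\
  (odd n -> isomorphic H (W_graph n)).
Proof.
have [Hfam minH] := hH; have [Hc _] := Hfam.
have n6 : (6 <= n)%N by apply: leq_trans hn.
have n5 : (5 <= n)%N by apply: leq_trans hn.
have n4 : (4 <= n)%N by apply: leq_trans hn.
have str := family_structure n4 Hfam.
pose mu := spectral_radius sigma (if odd n then W_graph n else D_graph n).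
have H_mu : spectral_radius sigma H <= mu.
  apply: minH; case: ifP => [o|/negbT o]; first exact: W_graph_in_family.
  exact: D_graph_in_family.
(* The maximum with 2 makes [decay_parameters] applicable; [kappa = 2] is settled by explicit
   values. *)
pose kappa := Num.max mu 2.
have k2 : 2 <= kappa by rewrite le_max lexx orbT.
have mu_k : mu <= kappa by rewrite le_max lexx.
have H_k := le_trans H_mu mu_k.
have [theta [e [th0 th1 thE eE]]] := decay_parameters hsigma0 hsigma1 k2.
have kcase : kappa = mu \/ kappa = 2.
  by rewrite /kappa; case: (leP mu 2) => _; [right|left].
have at2 : kappa = 2 -> theta = 1 /\
    0 <= 3 * sigma - kappa + 2 * (1 - sigma) * e + (1 - sigma).
  by move=> k; rewrite k in thE eE *; apply: branch_ge0_at2.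
have [oddn|evenn] := boolP (odd n).
  split=> // _; have muE : mu = spectral_radius sigma (W_graph n).
    by rewrite /mu oddn.
  have dn : 0 <= W_defect sigma kappa theta e n.
    case: kcase => [k|/at2[t1 b0]].
      rewrite leNgt; apply/negP => neg.
      have := W_radius_lt thE eE hsigma0 hsigma1 k2 th0 th1 n6 neg.
      by rewrite -muE k ltxx.
    by apply: W_defect_ge0; rewrite ?t1 ?mulr1.
  case: str => [emb|[m m6 emb]|[]|[]]; rewrite ?oddn //.
    have b0 := W_defect_star hsigma1 th0 th1 n6 dn.
    by case: (star5_not_embeds eE hsigma0 hsigma1 k2 Hc H_k hn b0 emb).
  have mn : (m <= n)%N.
    case: emb => f [injf _]; rewrite -[m]card_ord -[n]card_ord.
    exact: leq_card injf.
  have dm := W_defect_mono hsigma1 th0 th1 (introT andP (conj m6 mn)) dn.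
  have [_ mE [f bf fE] _] :=
    W_embeds_rigid thE eE hsigma0 hsigma1 k2 th0 Hc H_k m6 dm emb.
  by subst m; apply: isomorphic_of_bijection bf fE.
split=> // _; have muE : mu = spectral_radius sigma (D_graph n).
  by rewrite /mu (negbTE evenn).
(* Otherwise [D_radius_lt] would give mu < mu. *)
have strict : kappa = mu ->
    0 < 3 * sigma - kappa + 2 * (1 - sigma) * e + (1 - sigma) * theta.
  move=> k; rewrite ltNge; apply/negP => neg.
  have := D_radius_lt thE eE hsigma0 hsigma1 k2 th0 th1 n5.
  rewrite -muE k ltxx => ub; suff: false by [].
  by apply: ub; move: neg; rewrite k; lra.
have b0 : 0 <= 3 * sigma - kappa + 2 * (1 - sigma) * e + (1 - sigma) * theta.
  by case: kcase => [/strict/ltW //|/at2[-> //]]; rewrite mulr1.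
case: str => [emb|[m m6 emb]|[_ emb]|[_ emb]].
- have b1 : 0 <= 3 * sigma - kappa + 2 * (1 - sigma) * e + (1 - sigma).
    apply: le_trans b0 _; rewrite lerD2l ler_piMr //.
    by rewrite subr_ge0 ltW.
  by case: (star5_not_embeds eE hsigma0 hsigma1 k2 Hc H_k hn b1 emb).
(* Rigidity gives lambda(H) = kappa, so [kappa = mu]; then [strict] makes the defect positive,
   whereas rigidity makes it 0. *)
- have dm := W_defect_ge0 hsigma1 th0 th1 m6 b0.
  have [Hk _ _ d0] :=
    W_embeds_rigid thE eE hsigma0 hsigma1 k2 th0 Hc H_k m6 dm emb.
  have k : kappa = mu by apply/eqP; rewrite eq_le mu_k -Hk H_mu.
  have := W_defect_gt0 hsigma1 th0 th1 m6 (strict k).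
  by rewrite d0 ltxx.
- by case: (spider133_not_embeds thE eE hsigma0 hsigma1 k2 th0 th1 Hc H_k hn b0 emb).
(* [D_vec] falls short of the eigenvalue equation at the end leaf, so here the comparison is made at
   [mu] with the Perron vector of D_n. *)
have [w [w0 wE]] := Perron_vector hsigma0 hsigma1
  (leq_trans (isT : (0 < 5)%N) n5) (D_graph_connected n5).
have [f [injf homf]] := emb; have n0 : (0 < n)%N by apply: leq_trans n5.
have [|||| _ bf fE _] := @embed_rigid R sigma hsigma0 hsigma1 n n (D_graph n) H f
  w mu (Ordinal n0) Hc injf homf.
- by move=> i; rewrite ltW.
- by rewrite gt_eqF.
- rewrite /dotp mulr_sumr; apply: ler_sum => i _.
  by rewrite wE -muE mulrCA.
- exact: H_mu.
exact: isomorphic_of_bijection bf fE.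
Qed.
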